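(* Let $S$ be a semigroup, $X$ a compact metric space, and $S \curvearrowright X$ an action by continuous maps that is pointwise invariant-measure admitting, i.e. for every $x\in X$ there is at least one $S$-invariant Borel probability measure on $\operatorname{cl}_X(Sx)$. The following are equivalent: (1) $S \curvearrowright X$ is continuously pointwise ergodic. (2) $C(X) = \operatorname{Fix}(\kappa) \oplus \overline{\operatorname{Cob}}(\kappa)$. (3) $M(X) = \operatorname{Fix}(\kappa^* ) \oplus \overline{\operatorname{Cob}}^{*}(\kappa^* )$. If any of these holds, then: (i) The mean ergodic projection $P\colon C(X) \to \operatorname{Fix}(\kappa)$ (the projection onto $\operatorname{Fix}(\kappa)$ along $\overline{\operatorname{Cob}}(\kappa)$) is given by $(Pf)(x) = \int f\,d\Phi(x)$ for $f \in C(X)$, $x \in X$. (ii) The dual mean ergodic projection $Q\colon M(X) \to \operatorname{Fix}(\kappa^* )$ (the projection onto $\operatorname{Fix}(\kappa^* )$ along $\overline{\operatorname{Cob}}^{*}(\kappa^* )$) is given by $Q\nu = \int \Phi \, d\nu$ for $\nu \in M(X)$, where the integral is in the sense of Gelfand. (iii) The adjoint $P^*$ of $P$ satisfies $P^* = Q$ and $P^*\delta_x = \Phi(x)$ for all $x \in X$.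
   Context: $C(X)$ is the Banach space of real-valued continuous functions on $X$ with the sup norm; $M(X)$ is the space of finite signed regular Borel measures on $X$, identified with $C(X)^*$ via $\langle f,\nu\rangle=\int f\,d\nu$; the weak* topology on $M(X)$ is $\sigma(M(X),C(X))$. $M_1^+(X)$ is the set of Borel probability measures. $\delta_x$ is the Dirac measure at $x$. An action by continuous maps of $S$ on $X$ is a map $(s,x)\mapsto sx$ with $(st)x=s(tx)$ and each $x\mapsto sx$ continuous. $Sx=\{sx: s\in S\}$, and $\operatorname{cl}_X(Sx)$ is its closure. For $\nu\in M(X)$, $s_*\nu(A)=\nu(s^{-1}A)$; $\nu$ is $S$-invariant if $s_*\nu=\nu$ for all $s\in S$. For a closed set $A$ with $sA\subseteq A$ for all $s$, $M_1^+(A,S)$ denotes the $S$-invariant probability measures on $A$, identified with the $S$-invariant probability measures on $X$ whose support lies in $A$. $M_1^+(X,S)$ is the set of $S$-invariant probability measures on $X$. The Koopman representation is $(\kappa(s)f)(x)=f(sx)$ on $C(X)$, and the dual Koopman representation is $\kappa^*(s)\nu=s_*\nu$ on $M(X)$. $\operatorname{Fix}(\kappa)=\{f\in C(X):\kappa(s)f=f\ \forall s\in S\}$; $\operatorname{Cob}(\kappa)=\operatorname{span}\{f-\kappa(s)f: f\in C(X), s\in S\}$, with norm closure $\overline{\operatorname{Cob}}(\kappa)$. $\operatorname{Fix}(\kappa^* )=\{\nu\in M(X):\kappa^*(s)\nu=\nu\ \forall s\in S\}$; $\operatorname{Cob}(\kappa^* )=\operatorname{span}\{\nu-\kappa^*(s)\nu:\nu\in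 M(X),s\in S\}$, with weak* closure $\overline{\operatorname{Cob}}^{*}(\kappa^* )$. The action on the compact space $X$ is pointwise uniquely ergodic if for every $x\in X$ the set $M_1^+(\operatorname{cl}_X(Sx),S)$ has exactly one element; this element is denoted $\Phi(x)$, defining the pointwise ergodic map $\Phi\colon X\to M_1^+(X,S)$. The action is continuously pointwise ergodic if it is pointwise uniquely ergodic and $\Phi$ is weak* continuous. Gelfand integral: for $\Psi\colon X\to M(X)$ such that $x\mapsto \int f\,d\Psi(x)$ is measurable for every $f\in C(X)$, and $\nu\in M(X)$, $\int\Psi\,d\nu\in M(X)$ denotes the measure with $\langle f,\int\Psi\,d\nu\rangle=\int_X\left(\int f\,d\Psi(x)\right)d\nu(x)$ for all $f\in C(X)$. *)

(* Defs.v *)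
From HB Require Import structures.
From mathcomp Require Import all_boot all_order all_algebra.
From mathcomp Require Import all_classical all_reals all_analysis.

Set Implicit Arguments.
Unset Strict Implicit.
Unset Printing Implicit Defensive.

Import Order.TTheory GRing.Theory Num.Theory.
Import numFieldNormedType.Exports.

Local Open Scope classical_set_scope.
Local Open Scope ring_scope.

HB.mixin Record isCompactSpace T & Topological T := {
  compact_setT : compact [set: T]
}.

(** Pointed, hence nonempty, because the measurable types of MathComp-Analysis
    are pointed. *)
#[short(type="compactMetricType")]
HB.structure Definition CompactMetric (R : numDomainType) :=
  { X of Metric R X & isPointed X & isCompactSpace X }.

Section linear_algebra.
Context {K : nzRingType} {V : lmodType K}.
Implicit Types A B G : set V.

Definition linear_span G : set V :=
  [set v | exists n (a : 'I_n -> K) (w : 'I_n -> V),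
     (forall i, G (w i)) /\ v = \sum_(i < n) a i *: w i].

Definition direct_sum A B : Prop :=
  (forall v, exists a b, [/\ A a, B b & v = a + b]) /\ A `&` B = [set 0].

(** The projection onto [A] along [B]; meaningful when [V] is the direct sum of
    the linear subspaces [A] and [B], see [projection_alongP]. *)
Definition projection_along A B (v : V) : V := xget 0 [set a | A a /\ B (v - a)].

Lemma projection_alongP A B : direct_sum A B ->
  forall v, A (projection_along A B v) /\ B (v - projection_along A B v).
Proof.
move=> [ABv _] v; have [a [b [Aa Bb vab]]] := ABv v.
have ex : exists a, A a /\ B (v - a).
  by exists a; rewrite vab addrAC subrr add0r.
exact: (xgetPex 0 ex).
Qed.

Definition Fix {S : Type} (T : S -> V -> V) : set V :=
  [set v | forall s, T s v = v].

Definition Cob {S : Type} (T : S -> V -> V) : set V :=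
  linear_span [set w | exists v s, w = v - T s v].

End linear_algebra.

Definition C (R : realType) (X : topologicalType) : Type := continuousType X R.

Section continuous_functions.
Context {R : realType}.

HB.instance Definition _ (X : topologicalType) :=
  Choice.copy (C R X) (continuousType X R).

Section lmodule.
Context {X : topologicalType}.
Implicit Types f g h : C R X.

Let cst0 : C R X := cst (0 : R).

Let addc_cts f g : continuous (fun x => f x + g x).
Proof. by move=> x; apply: cvgD; exact: cts_fun. Qed.

Let oppc_cts f : continuous (fun x => - f x).
Proof. by move=> x; apply: cvgN; exact: cts_fun. Qed.

Let scalec_cts (r : R) f : continuous (fun x => r * f x).
Proof. by move=> x; apply: cvgM; [exact: cvg_cst|exact: cts_fun]. Qed.

Definition addc f g : C R X := mkcts (@addc_cts f g).
Definition oppc f : C R X := mkcts (@oppc_cts f).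
Definition scalec (r : R) f : C R X := mkcts (@scalec_cts r f).

Let addcA : associative addc.
Proof. by move=> f g h; apply/continuousEP => x /=; rewrite /mkcts addrA. Qed.

Let addcC : commutative addc.
Proof. by move=> f g; apply/continuousEP => x /=; rewrite /mkcts addrC. Qed.

Let add0c : left_id cst0 addc.
Proof. by move=> f; apply/continuousEP => x /=; rewrite /mkcts add0r. Qed.

Let addNc : left_inverse cst0 oppc addc.
Proof. by move=> f; apply/continuousEP => x /=; rewrite /mkcts addNr. Qed.

HB.instance Definition _ := GRing.isZmodule.Build (C R X) addcA addcC add0c addNc.

Let scalecA (a b : R) f : scalec a (scalec b f) = scalec (a * b) f.
Proof. by apply/continuousEP => x /=; rewrite /mkcts mulrA. Qed.

Let scale1c : left_id 1 scalec.
Proof. by move=> f; apply/continuousEP => x /=; rewrite /mkcts mul1r. Qed.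

Let scalecDr : right_distributive scalec +%R.
Proof. by move=> a f g; apply/continuousEP => x /=; rewrite /mkcts mulrDr. Qed.

Let scalecDl f : {morph scalec^~ f : a b / a + b}.
Proof. by move=> a b; apply/continuousEP => x /=; rewrite /mkcts mulrDl. Qed.

HB.instance Definition _ := GRing.Zmodule_isLmodule.Build R (C R X)
  scalecA scale1c scalecDr scalecDl.

Lemma cE0 x : (0 : C R X) x = 0. Proof. by []. Qed.
Lemma cED f g x : (f + g) x = f x + g x. Proof. by []. Qed.
Lemma cEN f x : (- f) x = - f x. Proof. by []. Qed.
Lemma cEB f g x : (f - g) x = f x - g x. Proof. by []. Qed.
Lemma cEZ (r : R) f x : (r *: f) x = r * f x. Proof. by []. Qed.

End lmodule.

Section sup_norm.
Context {X : compactMetricType R}.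
Implicit Types f g : C R X.

Definition sup_norm f : R := sup [set `|f x| | x in [set: X]].

Lemma sup_norm_has_sup f : has_sup [set `|f x| | x in [set: X]].
Proof.
split; first by exists `|f point|; exists point.
have cf : compact (f @` [set: X]).
  apply: continuous_compact; last exact: compact_setT.
  by apply: continuous_subspaceT; exact: cts_fun.
have [M [Mreal fM]] := compact_bounded cf.
exists (M + 1) => _ [x _ <-].
by apply: (fM (M + 1)); [rewrite ltrDl|exists x].
Qed.

Lemma sup_norm_ge f x : `|f x| <= sup_norm f.
Proof. by apply: sup_upper_bound; [exact: sup_norm_has_sup|exists x]. Qed.

Lemma sup_norm_le f (M : R) : (forall x, `|f x| <= M) -> sup_norm f <= M.
Proof.
move=> fM; apply: ge_sup; first by exists `|f point|; exists point.
by move=> _ [x _ <-].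
Qed.

Let sup_normD f g : sup_norm (f + g) <= sup_norm f + sup_norm g.
Proof.
apply: sup_norm_le => x.
by rewrite cED (le_trans (ler_normD _ _))// lerD// sup_norm_ge.
Qed.

Let sup_normZ (r : R) f : sup_norm (r *: f) = `|r| * sup_norm f.
Proof.
apply/eqP; rewrite eq_le; apply/andP; split.
  by apply: sup_norm_le => x; rewrite cEZ normrM ler_wpM2l// sup_norm_ge.
have [->|r0] := eqVneq r 0.
  by rewrite normr0 mul0r (le_trans _ (sup_norm_ge _ point)).
rewrite mulrC -ler_pdivlMr ?normr_gt0//; apply: sup_norm_le => x.
rewrite ler_pdivlMr ?normr_gt0// mulrC -normrM -cEZ.
exact: sup_norm_ge.
Qed.

Let sup_norm0_eq0 f : sup_norm f = 0 -> f = 0.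
Proof.
move=> f0; apply/continuousEP => x; rewrite cE0; apply/eqP.
by rewrite -normr_le0 -f0 sup_norm_ge.
Qed.

HB.instance Definition _ := Lmodule_isNormed.Build R (C R X)
  sup_normD sup_normZ sup_norm0_eq0.

End sup_norm.

End continuous_functions.

Definition borel (X : ptopologicalType) : Type := g_sigma_algebraType (@open X).

HB.instance Definition _ (X : ptopologicalType) :=
  Measurable.copy (borel X) (g_sigma_algebraType (@open X)).

(** A charge of the library is a total function [set T -> \bar R], with
    arbitrary values on nonmeasurable sets; these values are set to 0 here so
    that equality in [M R X] is equality on Borel sets.  Regularity is not
    required because it is automatic on compact metric spaces, see
    [M_regular]. *)
Record M (R : realType) (X : ptopologicalType) : Type := MkM {
  M_charge :> {charge set (borel X) -> \bar R} ;
  M_out : forall A, ~ measurable A -> M_charge A = 0%E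
}.

Section signed_measures.
Context {R : realType} {X : ptopologicalType}.
Implicit Types (mu nu : M R X) (A : set (borel X)).

HB.instance Definition _ := gen_eqMixin (M R X).
HB.instance Definition _ := gen_choiceMixin (M R X).

Lemma M_ext mu nu : (forall A, measurable A -> mu A = nu A) -> mu = nu.
Proof.
move=> munu; have {}munu : (mu : set _ -> \bar R) = nu.
  apply/funext => A; have [/munu//|nA] := pselect (measurable A).
  by rewrite !M_out.
case: mu nu munu => [mu mu0] [nu nu0] /= munu.
have {}munu : mu = nu.
  case: mu nu munu {mu0 nu0} => [mu [[a] [b] [c]]] [nu [[a'] [b'] [c']]] /= munu.
  case: _ / munu in a' b' c' *.
  by rewrite (Prop_irrelevance a a') (Prop_irrelevance b b') (Prop_irrelevance c c').
case: _ / munu in nu0 *.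
by rewrite (Prop_irrelevance mu0 nu0).
Qed.

Let M_of_out (nu : {charge set (borel X) -> \bar R}) A :
  ~ measurable A -> crestr0 nu measurableT A = 0%E.
Proof. by move=> nA; rewrite /crestr0 memNset. Qed.

Definition M_of (nu : {charge set (borel X) -> \bar R}) : M R X :=
  MkM (M_of_out nu).

Lemma M_ofE (nu : {charge set (borel X) -> \bar R}) A :
  measurable A -> M_of nu A = nu A.
Proof. by move=> mA; rewrite /= /crestr0 mem_set// /crestr setIT. Qed.

Definition M0 : M R X := M_of (@czero _ (borel X) R).
Definition M_add mu nu : M R X := M_of (cadd mu nu).
Definition M_opp mu : M R X := M_of (copp mu).
Definition M_scale (r : R) mu : M R X := M_of (cscale r mu).

Let M_addA : associative M_add.
Proof.
move=> a b c; apply: M_ext => A mA.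
by rewrite !M_ofE//= /cadd !M_ofE//= /cadd addeA.
Qed.

Let M_addC : commutative M_add.
Proof. by move=> a b; apply: M_ext => A mA; rewrite !M_ofE//= /cadd addeC. Qed.

Let M_add0 : left_id M0 M_add.
Proof.
by move=> a; apply: M_ext => A mA; rewrite !M_ofE//= /cadd M_ofE//= /czero add0e.
Qed.

Let M_addN : left_inverse M0 M_opp M_add.
Proof.
move=> a; apply: M_ext => A mA; rewrite !M_ofE//= /cadd M_ofE//= /copp/= /czero.
by rewrite addeC subee// fin_num_measure.
Qed.

HB.instance Definition _ := GRing.isZmodule.Build (M R X)
  M_addA M_addC M_add0 M_addN.

Let M_scaleA (r s : R) mu : M_scale r (M_scale s mu) = M_scale (r * s) mu.
Proof.
by apply: M_ext => A mA; rewrite !M_ofE//= /cscale M_ofE//= /cscale EFinM muleA.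
Qed.

Let M_scale1 : left_id 1 M_scale.
Proof. by move=> a; apply: M_ext => A mA; rewrite !M_ofE//= /cscale mul1e. Qed.

Let M_scaleDr : right_distributive M_scale +%R.
Proof.
move=> r a b; apply: M_ext => A mA.
rewrite !M_ofE//= /cadd /cscale/= !M_ofE//= /cadd /cscale/=.
by rewrite muleDr// fin_num_adde_defr// fin_num_measure.
Qed.

Let M_scaleDl mu : {morph M_scale^~ mu : r s / r + s}.
Proof.
move=> r s; apply: M_ext => A mA.
rewrite !M_ofE//= /cadd /cscale/= !M_ofE//= /cscale/= EFinD.
by rewrite -(fineK (fin_num_measure mu A mA)) -!EFinM -EFinD mulrDl.
Qed.

HB.instance Definition _ := GRing.Zmodule_isLmodule.Build R (M R X)
  M_scaleA M_scale1 M_scaleDr M_scaleDl.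

Lemma ME0 A : (0 : M R X) A = 0%E.
Proof. by rewrite /= /crestr0; case: ifP. Qed.

Lemma MED mu nu A : measurable A -> (mu + nu) A = (mu A + nu A)%E.
Proof. by move=> mA; rewrite M_ofE. Qed.

Lemma MEN mu A : measurable A -> (- mu) A = (- mu A)%E.
Proof. by move=> mA; rewrite M_ofE. Qed.

Lemma MEZ (r : R) mu A : measurable A -> (r *: mu) A = (r%:E * mu A)%E.
Proof. by move=> mA; rewrite M_ofE. Qed.

Definition delta (x : X) : M R X :=
  M_of (charge_of_finite_measure (@dirac _ (borel X) x R)).

Lemma deltaE x A : measurable A -> delta x A = \d_(x : borel X) A.
Proof. by move=> mA; rewrite M_ofE. Qed.

(** Integral with respect to a signed measure, by Jordan decomposition. *)
Definition integralM nu (f : X -> R) : R :=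
  let H := cid (Hahn_decomposition nu) in
  let nuPN := projT2 (cid (projT2 H)) in
  \int[jordan_pos nuPN]_x f x - \int[jordan_neg nuPN]_x f x.

(** The duality pairing [<f, nu>] identifying [M R X] with the dual of
    [C R X]. *)
Definition pairing (f : C R X) nu : R := integralM nu f.

End signed_measures.

(** The weak* topology [sigma(M(X), C(X))]. *)
HB.instance Definition _ (R : realType) (X : ptopologicalType) :=
  Topological.copy (M R X)
    (initial_topology (fun nu => pairing^~ nu : {ptws C R X -> R})).

Section regularity.
Context {R : realType} {X : compactMetricType R}.
Implicit Types (A B F U : set X).

Let open_borel U : open U -> measurable (U : set (borel X)).
Proof. by move=> oU; exact: sub_sigma_algebra. Qed.

Let closed_borel F : closed F -> measurable (F : set (borel X)).
Proof.
by move=> cF; rewrite -(setCK F); apply: measurableC; apply: open_borel; exact: closed_openC.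
Qed.

Section finite_measure.
Variable mu : {measure set (borel X) -> \bar R}.
Hypothesis mu_fin : (mu [set: borel X] < +oo)%E.

Let approx A := forall e : R, 0 < e -> exists F U,
  [/\ closed F, open U, F `<=` A, A `<=` U & (mu (U `\` F) < e%:E)%E].

Let mu_le A B : measurable (A : set (borel X)) -> measurable (B : set (borel X)) ->
  A `<=` B -> (mu A <= mu B)%E.
Proof. by move=> mA mB AB; rewrite le_measure// inE. Qed.

Let mu_lty A : measurable (A : set (borel X)) -> (mu A < +oo)%E.
Proof. by move=> mA; rewrite (le_lt_trans _ mu_fin)// mu_le. Qed.

Let mu_cap (F : (set X)^nat) (e : R) : 0 < e ->
  (forall n, measurable (F n : set (borel X))) ->
  {homo F : n m / (n <= m)%N >-> (m <= n)%O} -> \bigcap_n F n = set0 ->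
  exists n, (mu (F n) < e%:E)%E.
Proof.
move=> e0 mF dF F0.
have mcap : measurable (\bigcap_n F n : set (borel X)) by rewrite F0; exact: measurable0.
have := @nonincreasing_cvg_mu _ (borel X) R mu F (mu_lty (mF 0%N)) mF mcap dF.
rewrite F0 measure0 => /(_ [set y | (y < e%:E)%E]) /=.
case; first by apply: open_ereal_lt'; rewrite lte_fin.
by move=> n _ /(_ n (leqnn n)) /= Fn; exists n.
Qed.

Let approx_open U : open U -> approx U.
Proof.
move=> oU e e0.
pose G n := \bigcup_(y in ~` U) (ball y (n.+1%:R^-1 : R))°.
have oG n : open (G n).
  by apply: bigcup_open => y _; exact: open_interior.
have UG : ~` U `<=` \bigcap_n G n.
  by move=> y Uy n _; exists y => //; apply: nbhsx_ballx.
have GU : \bigcap_n G n `<=` ~` U.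
  move=> x Gx Ux; move: oU; rewrite openE => /(_ _ Ux) /nbhs_ballP[d /= d0 dU].
  have [n nd] : exists n, n.+1%:R^-1 < d.
    have [n _ /(_ n (leqnn n)) nd] := near_infty_natSinv_lt (PosNum d0).
    by exists n.
  have [y nUy /interior_subset/ball_sym xy] := Gx n I.
  by apply: nUy; apply: dU; apply: le_ball xy; exact: ltW.
have [n Gn] : exists n, (mu (G n `&` U) < e%:E)%E.
  apply: (@mu_cap (fun n => G n `&` U)) => //.
  - by move=> n; apply: measurableI; exact: open_borel.
  - move=> n m nm; apply/subsetPset; apply: setSI => x [y Uy yx]; exists y => //.
    apply: interiorS yx; apply: le_ball.
    by rewrite lef_pV2 ?posrE// ler_nat ltnS.
  - by rewrite -subset0 => x h; have [_ Ux] := h 0%N I; apply: (GU x) Ux => i _; case: (h i I).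
exists (~` G n), U; split => //.
- exact: open_closedC.
- by move=> x nG; apply: contrapT => /UG /(_ n I).
- by rewrite setDE setCK setIC.
Qed.

Let approxC A : approx A -> approx (~` A).
Proof.
move=> aA e /aA[F [U [cF oU FA AU FU]]]; exists (~` U), (~` F); split.
- exact: open_closedC.
- exact: closed_openC.
- exact: subsetC.
- exact: subsetC.
- by rewrite setDE setCK setIC.
Qed.

Let approx_bigcup (A : (set X)^nat) : (forall n, approx (A n)) ->
  approx (\bigcup_n A n).
Proof.
move=> aA e e0.
have e2 : 0 < e / 2 by rewrite divr_gt0.
have en n : 0 < e / 2 / (2 ^ n.+1)%:R by rewrite divr_gt0.
have /choice[FU FUP] n : exists FU, [/\ closed FU.1, open FU.2,
    FU.1 `<=` A n, A n `<=` FU.2 & (mu (FU.2 `\` FU.1) < (e / 2 / (2 ^ n.+1)%:R)%:E)%E].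
  by have [F [U ?]] := aA n _ (en n); exists (F, U).
pose F n := (FU n).1; pose U n := (FU n).2.
have cF n : closed (F n) by case: (FUP n).
have oU n : open (U n) by case: (FUP n).
have FA n : F n `<=` A n by case: (FUP n).
have AU n : A n `<=` U n by case: (FUP n).
have FUe n : (mu (U n `\` F n) <= (e / 2 / (2 ^ n.+1)%:R)%:E)%E.
  by case: (FUP n) => _ _ _ _ /ltW.
have mF n : measurable (F n : set (borel X)) by exact: closed_borel.
have mU n : measurable (U n : set (borel X)) by exact: open_borel.
pose V := \bigcup_n U n.
have mV : measurable (V : set (borel X)) by exact: bigcup_measurable.
pose H n := \big[setU/set0]_(i < n) F i.
have cH n : closed (H n) by apply: closed_bigsetU.
have mH n : measurable (H n : set (borel X)) by exact: closed_borel.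
pose HH := \bigcup_n F n.
have mHH : measurable (HH : set (borel X)) by exact: bigcup_measurable.
have VH : (mu (V `\` HH) <= (e / 2)%:E)%E.
  apply: (@le_trans _ _ (\sum_(n <oo) mu (U n `\` F n))%E).
    apply: measure_sigma_subadditive.
    - by move=> n; exact: measurableD.
    - exact: measurableD.
    - move=> x [[n _ Unx] nH]; exists n => //; split=> // Fnx.
      by apply: nH; exists n.
  apply: (@le_trans _ _ (\sum_(n <oo) (e / 2 / (2 ^ n.+1)%:R)%:E)%E).
    by apply: lee_nneseries => // n _.
  by apply: (epsilon_trick0 xpredT); exact: ltW.
have [N HN] : exists n, (mu (HH `\` H n) < (e / 2)%:E)%E.
  apply: (@mu_cap (fun n => HH `\` H n)) => //.
  - by move=> n; exact: measurableD.
  - move=> n m nm; apply/subsetPset; apply: setDS.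
    by apply: subset_bigsetU.
  - rewrite -subset0 => x h; have [[k _ Fkx] _] := h 0%N I.
    have [_ +] := h k.+1 I; apply.
    by rewrite /H -bigcup_mkord; exists k => //=.
exists (H N), V; split.
- exact: cH.
- exact: bigcup_open.
- by rewrite /H -bigcup_mkord => x [k _ /FA Akx]; exists k.
- by move=> x [k _ /AU Ukx]; exists k.
apply: (@le_lt_trans _ _ (mu ((V `\` HH) `|` (HH `\` H N)))).
  apply: mu_le; first exact: measurableD.
    by apply: measurableU; exact: measurableD.
  move=> x [Vx nH]; have [Hx|nHx] := pselect (HH x); [by right|by left].
have mm1 : measurable (V `\` HH : set (borel X)) by exact: measurableD.
have mm2 : measurable (HH `\` H N : set (borel X)) by exact: measurableD.
apply: (@le_lt_trans _ _ (mu (V `\` HH) + mu (HH `\` H N))%E).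
  exact: measureU2.
rewrite [e]splitr EFinD; apply: lee_ltD => //.
by rewrite ge0_fin_numE// (le_lt_trans VH)// ltry.
Qed.

Lemma finite_borel_measure_regular A (e : R) :
  measurable (A : set (borel X)) -> 0 < e -> exists F U,
  [/\ closed F, open U, F `<=` A, A `<=` U & (mu (U `\` F) < e%:E)%E].
Proof.
move=> mA; move: e; suff : <<s @open X >> `<=` approx by exact.
apply: smallest_sub => //; split.
- exact/approx_open/open0.
- by move=> B aB; rewrite setTD; exact: approxC.
- exact: approx_bigcup.
Qed.

End finite_measure.

Lemma M_regular (nu : M R X) A (e : R) :
  measurable (A : set (borel X)) -> 0 < e ->
  exists F U, [/\ compact F, open U, F `<=` A, A `<=` U &
    forall B, measurable (B : set (borel X)) -> B `<=` U `\` F ->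
      (`|nu B| < e%:E)%E].
Proof.
move=> mA e0; have [P [N nuPN]] := Hahn_decomposition nu.
pose mu := charge_variation nuPN.
have mufin : (mu [set: borel X] < +oo)%E.
  by rewrite -ge0_fin_numE// /mu fin_numD !fin_num_measure.
have [F [U [cF oU FA AU FU]]] := finite_borel_measure_regular mufin mA e0.
exists F, U; split => //.
  by apply: (subclosed_compact cF compact_setT).
move=> B mB BFU; apply: le_lt_trans (abse_charge_variation nuPN mB) _.
apply: le_lt_trans FU; rewrite le_measure// ?inE//.
by apply: measurableD; [exact: open_borel|exact: closed_borel].
Qed.

End regularity.

Record cts_action (S : semigroupType) (X : topologicalType) : Type := CtsAction {
  act :> S -> continuousType X X ;
  actM : forall s t x, act (s * t)%g x = act s (act t x)
}.

Section koopman.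
Context {R : realType} {S : semigroupType} {X : ptopologicalType}.
Variable a : cts_action S X.

Definition koopman (s : S) (f : C R X) : C R X := f \o a s.

Let act_measurable (s : S) :
  measurable_fun [set: borel X] (a s : borel X -> borel X).
Proof.
apply: (@measurability _ _ (borel X) (borel X) setT (a s) (@open X)) => // _ [U oU <-].
rewrite setTI.
apply: sub_sigma_algebra; apply: open_comp => // x _; exact: cts_fun.
Qed.

Definition dual_koopman (s : S) (nu : M R X) : M R X :=
  M_of (measure_function_pushforward__canonical__charge_Charge
          nu (act_measurable s)).

Lemma dual_koopmanE (s : S) (nu : M R X) (A : set (borel X)) : measurable A ->
  dual_koopman s nu A = nu (a s @^-1` A).
Proof. by move=> mA; rewrite M_ofE. Qed.

End koopman.

Section pointwise_ergodicity.
Context {R : realType} {S : semigroupType} {X : ptopologicalType}.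
Variable a : cts_action S X.

Definition action_orbit (x : X) : set X := [set y | exists s, y = a s x].

Definition is_probability (nu : M R X) : Prop :=
  (forall A, measurable A -> (0 <= nu A)%E) /\ nu [set: borel X] = 1%E.

(** For nonnegative [nu] only. *)
Definition measure_support (nu : M R X) : set X :=
  [set x | forall U : set X, open U -> U x -> (0 < nu U)%E].

(** [M_1^+(A, S)], as a set of measures on [X]. *)
Definition invariant_probabilities (A : set X) : set (M R X) :=
  [set nu | [/\ is_probability nu, Fix (dual_koopman a) nu & measure_support nu `<=` A]].

Definition pointwise_invariant_measure_admitting : Prop :=
  forall x, invariant_probabilities (closure (action_orbit x)) !=set0.

Definition pointwise_uniquely_ergodic : Prop :=
  forall x, exists! nu, invariant_probabilities (closure (action_orbit x)) nu.

(** The pointwise ergodic map [Phi]; meaningful when the action is pointwise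
    uniquely ergodic, the value 0 being used when there is no invariant
    probability measure on the orbit closure. *)
Definition ergodic_map (x : X) : M R X :=
  xget 0 (invariant_probabilities (closure (action_orbit x))).

Definition continuously_pointwise_ergodic : Prop :=
  pointwise_uniquely_ergodic /\ continuous ergodic_map.

End pointwise_ergodicity.

Section gelfand.
Context {R : realType} {X : ptopologicalType}.

Definition is_gelfand_integral (Psi : X -> M R X) (nu mu : M R X) : Prop :=
  (forall f : C R X,
    measurable_fun [set: borel X] (fun x : borel X => pairing f (Psi x))) /\
  (forall f : C R X, pairing f mu = integralM nu (fun x => pairing f (Psi x))).

(** [Q] is the adjoint of [P], the dual of [C R X] being identified with
    [M R X]. *)
Definition is_adjoint (P : C R X -> C R X) (Q : M R X -> M R X) : Prop :=
  forall (f : C R X) (nu : M R X), pairing f (Q nu) = pairing (P f) nu.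

End gelfand.

Arguments continuously_pointwise_ergodic : clear implicits.
Arguments continuously_pointwise_ergodic R {S X} a.
Arguments pointwise_uniquely_ergodic : clear implicits.
Arguments pointwise_uniquely_ergodic R {S X} a.
Arguments pointwise_invariant_measure_admitting : clear implicits.
Arguments pointwise_invariant_measure_admitting R {S X} a.
Arguments koopman R {S X} a s f.
Arguments dual_koopman R {S X} a s nu.
Arguments ergodic_map R {S X} a x.
Arguments delta R {X} x.

(* Main.v *)
Require Import Defs.
From HB Require Import structures.
From mathcomp Require Import all_boot all_order all_algebra.
From mathcomp Require Import all_classical all_reals all_analysis.
From mathcomp Require Import measurable_realfun ring lra.

(** Write [F] for the fixed functions, [N] for the invariant signed measures,
    and [K x] for the orbit closure of [x]. Everything rests on the duality
    between [C(X)] and [M(X)]: the closure of the coboundaries of [koopman] is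
    the annihilator of [N] ([CobC_annihilator]), and the weak-star closure of the
    coboundaries of [dual_koopman] is the annihilator of [F]
    ([CobM_annihilator]). The first fact needs the theorem of Hahn-Banach and
    the Riesz representation of positive functionals ([hahn_banach],
    [riesz_representation]); the second one is linear algebra, as a weak-star
    neighbourhood involves finitely many functions.

    A fixed function is constant on [K x], so an invariant probability measure
    on [K x] integrates it to its value at [x] ([pairing_Fix]). Consequently, if
    [C(X)] is the direct sum of [F] and the closed coboundaries, the projection
    is [P f x = <f, mu>] for every such measure [mu]; being positive, [P] has an
    adjoint on measures, which is the projection required for the decomposition
    of [M(X)] ([direct_sum_dual]). If [M(X)] decomposes, then [N] meets the
    annihilator of [F] only in 0. This gives uniqueness of the invariant measure
    on [K x] and the density of [F] plus the coboundaries, and continuity of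
    [Phi] follows by uniform approximation ([dual_direct_sum_ergodic]).

    The remaining implication is the heart of the matter. If [Phi] is
    continuous, [p x = <f, Phi x>] is a fixed continuous function and [g = f - p]
    satisfies [<g, Phi x> = 0] for all [x]; one must show that [g] is orthogonal
    to every invariant measure ([invariant_pairing0]). The Jordan parts of an
    invariant measure are invariant, so let the measure be positive. On each
    [K x] separation yields a coboundary [w] with [g <= w + e]. As [C(X)] is
    separable, countably many [w] suffice, and the points at which a given [w]
    works form a closed forward invariant set. An invariant measure therefore
    splits into invariant pieces, on each of which [g] lies below a coboundary
    plus [e] along orbits, so that the integral of [g] is at most [e] times the
    mass ([invariant_integral_le0]); the same holds for [- g]. *)

Import Order.TTheory GRing.Theory Num.Theory.
Import numFieldNormedType.Exports.
Set Implicit Arguments.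
Unset Strict Implicit.
Unset Printing Implicit Defensive.
Local Open Scope classical_set_scope.
Local Open Scope ring_scope.

(** * The Hahn-Banach theorem *)

Section hahn_banach.
Context {R : realType} {V : lmodType R}.
Implicit Types (p q : V -> R) (u v w : V).

Definition sublinear p : Prop :=
  (forall u v, p (u + v) <= p u + p v) /\
  (forall (t : R) v, 0 <= t -> p (t *: v) = t * p v).

Lemma sublinear0 p : sublinear p -> p 0 = 0.
Proof. by move=> [_ /(_ 0 0 (lexx 0))]; rewrite scale0r mul0r. Qed.

Lemma sublinearN p v : sublinear p -> - p (- v) <= p v.
Proof.
move=> sp; have := sp.1 v (- v).
by rewrite subrr (sublinear0 sp) -lerBlDr sub0r.
Qed.

(** The sublinear functional below [p] obtained by forcing the value [- p w] at
    [- w]. A minimal sublinear functional coincides with all its tilts, which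
    says that it is additive. *)
Definition tilt p w v : R :=
  inf [set p (v + t *: w) - t * p w | t in [set t : R | 0 <= t]].

Lemma tilt_has_inf p w v : sublinear p ->
  has_inf [set p (v + t *: w) - t * p w | t in [set t : R | 0 <= t]].
Proof.
move=> sp; split; first by exists (p (v + 0 *: w) - 0 * p w); exists 0 => /=.
exists (- p (- v)) => _ [t /= t0 <-].
have := sp.1 (v + t *: w) (- v).
rewrite addrAC subrr add0r sp.2//; lra.
Qed.

Lemma tilt_le p w v (t : R) : sublinear p -> 0 <= t ->
  tilt p w v <= p (v + t *: w) - t * p w.
Proof.
move=> sp t0; apply: ge_inf; last by exists t.
by have [_] := tilt_has_inf w v sp.
Qed.

Lemma le_tilt p w v (x : R) : sublinear p ->
  (forall t : R, 0 <= t -> x <= p (v + t *: w) - t * p w) -> x <= tilt p w v.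
Proof.
move=> sp xp; apply: lb_le_inf; first by have [] := tilt_has_inf w v sp.
by move=> _ [t /= t0 <-]; exact: xp.
Qed.

Lemma sublinear_tilt p w : sublinear p -> sublinear (tilt p w).
Proof.
move=> sp; split=> [u v|t v t0].
  rewrite -lerBlDr; apply: le_tilt => // t t0.
  rewrite lerBlDr -lerBlDl; apply: le_tilt => // s s0.
  have := @tilt_le p w (u + v) (t + s) sp (addr_ge0 t0 s0).
  have := sp.1 (u + t *: w) (v + s *: w).
  rewrite addrACA -scalerDl; lra.
have h s x : 0 < s -> s * tilt p w x <= tilt p w (s *: x).
  move=> s0; apply: le_tilt => // r r0.
  rewrite mulrC -ler_pdivlMr//.
  apply: le_trans (tilt_le w x sp (divr_ge0 r0 (ltW s0))) _.
  rewrite ler_pdivlMr//.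
  have := sp.2 s (x + (r / s) *: w) (ltW s0).
  rewrite scalerDr scalerA [s * _]mulrC divfK ?gt_eqF// => ->.
  by rewrite mulrBl [_ * s]mulrC mulrAC divfK ?gt_eqF.
move: t0; rewrite le_eqVlt => /predU1P[<-|t0].
  rewrite scale0r mul0r; apply/eqP; rewrite eq_le; apply/andP; split.
    have := tilt_le w 0 sp (lexx 0).
    by rewrite scale0r addr0 (sublinear0 sp) mul0r subr0.
  by apply: le_tilt => // s s0; rewrite add0r sp.2// subrr.
apply/eqP; rewrite eq_le h// andbT.
have := h t^-1 (t *: v); rewrite invr_gt0 => /(_ t0).
by rewrite scalerA mulVf ?gt_eqF// scale1r mulrC ler_pdivrMr// mulrC.
Qed.

Lemma tilt_le_id p w v : sublinear p -> tilt p w v <= p v.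
Proof.
move=> sp; have := tilt_le w v sp (lexx 0).
by rewrite scale0r addr0 mul0r subr0.
Qed.

Lemma tiltN p w : sublinear p -> tilt p w (- w) <= - p w.
Proof.
move=> sp; have := tilt_le w (- w) sp ler01.
by rewrite scale1r addNr (sublinear0 sp) mul1r sub0r.
Qed.

(** Zorn's lemma applies because the sublinear minorants of [p] are bounded below
    by [- p (- v)], so that the infimum of a chain is again one of them. *)
Lemma minimal_sublinear p : sublinear p -> exists q, [/\ sublinear q,
  forall v, q v <= p v &
  forall q', sublinear q' -> (forall v, q' v <= q v) -> q' = q].
Proof.
move=> sp.
pose T := {q : V -> R | sublinear q /\ forall v, q v <= p v}.
pose r (q q' : T) := `[< forall v, sval q' v <= sval q v >].
(* the pointwise infimum bounds a nonempty chain; [p] bounds the empty one *)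
have rP (A : set T) : total_on A r -> exists t, forall s, A s -> r s t.
  move=> totA; have [[q0 Aq0]|A0] := pselect (A !=set0); last first.
    have pT : sublinear p /\ forall v, p v <= p v by [].
    by exists (exist _ p pT) => s As; exfalso; apply: A0; exists s.
  pose E v := [set sval q v | q in A].
  have Einf v : has_inf (E v).
    split; first by exists (sval q0 v); exists q0.
    exists (- p (- v)) => _ [[q [sq qp]] Aq <-] /=.
    by apply: le_trans (sublinearN v sq); rewrite lerN2.
  have mle (q : T) v : A q -> inf (E v) <= sval q v.
    by move=> Aq; apply: ge_inf; [have [] := Einf v|exists q].
  have leinf (x : R) v : (forall q : T, A q -> x <= sval q v) -> x <= inf (E v).
    move=> h; apply: lb_le_inf; first by have [] := Einf v.
    by move=> _ [q Aq <-]; exact: h.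
  have mT : sublinear (fun v => inf (E v)) /\ forall v, inf (E v) <= p v.
    split; last by move=> v; apply: le_trans (mle q0 v Aq0) _; exact: (svalP q0).2.
    split=> [u v|t v t0].
      rewrite -lerBlDr/=; apply: (leinf _ _) => q Aq; rewrite lerBlDr -lerBlDl/=.
      apply: (leinf _ _) => q' Aq'; rewrite lerBlDl.
      have [/asboolP qq'|/asboolP qq'] := totA _ _ Aq Aq'.
        apply: le_trans (mle q' _ Aq') _.
        by apply: le_trans ((svalP q').1.1 _ _) _; rewrite lerD2r.
      apply: le_trans (mle q _ Aq) _.
      by apply: le_trans ((svalP q).1.1 _ _) _; rewrite lerD2l.
    move: t0; rewrite le_eqVlt => /predU1P[<-|t0].
      rewrite scale0r mul0r; apply/eqP; rewrite eq_le; apply/andP; split.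
        by apply: le_trans (mle q0 0 Aq0) _; rewrite (sublinear0 (svalP q0).1).
      by apply: (leinf _ _) => q _; rewrite (sublinear0 (svalP q).1).
    apply/eqP; rewrite eq_le; apply/andP; split.
      rewrite mulrC -ler_pdivrMr//; apply: (leinf _ _) => q Aq; rewrite ler_pdivrMr// mulrC.
      by rewrite -(svalP q).1.2 ?(ltW t0)//; exact: mle.
    apply: (leinf _ _) => q Aq; rewrite (svalP q).1.2 ?(ltW t0)// ler_pM2l//.
    exact: mle.
  exists (exist _ (fun v => inf (E v)) mT : T) => q Aq; apply/asboolP => v /=; exact: mle.
have [|||[q [sq qp]] qmin] := Zorn _ _ _ rP.
- by move=> q; apply/asboolP.
- move=> q1 q2 q3 /asboolP h12 /asboolP h23; apply/asboolP => v.
  exact: le_trans (h23 v) (h12 v).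
- move=> [q1 h1] [q2 h2] /asboolP/= h12 /asboolP/= h21; apply/eq_exist.
  by apply/funext => v; apply/eqP; rewrite eq_le h12 h21.
exists q; split => // q' sq' q'q.
have q'T : sublinear q' /\ forall v, q' v <= p v.
  by split => // v; exact: le_trans (q'q v) (qp v).
have := qmin (exist _ q' q'T); rewrite /r/= => /(_ _)/wrap[|[]//].
exact/asboolP.
Qed.

(** A minimal functional below [tilt p w] is linear; starting from the tilt
    rather than from [p] gives the value [p w] at [w]. *)
Theorem hahn_banach p w : sublinear p ->
  exists l : {scalar V}, (forall v, l v <= p v) /\ l w = p w.
Proof.
move=> sp; have [q [sq qp qmin]] := minimal_sublinear (sublinear_tilt w sp).
have qD u v : q (u + v) = q u + q v.
  apply/eqP; rewrite eq_le sq.1/=.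
  have -> : q u = tilt q v u.
    by rewrite (qmin _ (sublinear_tilt v sq) (fun x => tilt_le_id v x sq)).
  have := tilt_le v u sq ler01; rewrite scale1r mul1r; lra.
have qN v : q (- v) = - q v.
  by have := qD v (- v); rewrite subrr (sublinear0 sq); lra.
have qlin : scalar q.
  move=> a u v; rewrite qD; congr (_ + _).
  have [a0|a0] := leP 0 a; first by rewrite sq.2.
  by rewrite -[a]opprK scaleNr qN sq.2 ?mulNr// oppr_ge0 ltW.
pose l : {scalar V} := HB.pack q (GRing.isLinear.Build R V R *%R q qlin).
exists l; split=> [v|]; first exact: le_trans (qp v) (tilt_le_id w v sp).
apply/eqP; rewrite eq_le; apply/andP; split.
  exact: le_trans (qp w) (tilt_le_id w w sp).
have := le_trans (qp (- w)) (tiltN w sp).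
by rewrite qN lerN2.
Qed.

End hahn_banach.

(** * Continuous functions and finite Borel measures *)

Section continuous_operations.
Context {R : realType} {X : topologicalType}.
Implicit Types f g : C R X.

(** Locked, since a constant function left transparent unifies with any function
    value when rewriting. *)
Definition cst_c (r : R) : C R X := locked (cst r : C R X).

Let mul_cts f g : continuous (fun x => f x * g x).
Proof. by move=> x; apply: cvgM; exact: cts_fun. Qed.

Definition mul_c f g : C R X := mkcts (@mul_cts f g).

Let min_cts f g : continuous (fun x => Num.min (f x) (g x)).
Proof.
under eq_fun do rewrite minr_absE.
move=> x; apply: cvgM; last exact: cvg_cst.
by apply: cvgB; [|apply: cvg_norm]; [apply: cvgD|apply: cvgB]; exact: cts_fun.
Qed.

Definition min_c f g : C R X := mkcts (@min_cts f g).

Lemma cst_cE r x : cst_c r x = r. Proof. by rewrite /cst_c -lock. Qed.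
Lemma mul_cE f g x : mul_c f g x = f x * g x. Proof. by []. Qed.
Lemma min_cE f g x : min_c f g x = Num.min (f x) (g x). Proof. by []. Qed.

Lemma sum_cE I (r : seq I) (P : pred I) (F : I -> C R X) x :
  (\sum_(i <- r | P i) F i) x = \sum_(i <- r | P i) F i x.
Proof. by elim/big_rec2: _ => // i y f Pi <-. Qed.

End continuous_operations.

Definition cE := (@cst_cE, @mul_cE, @min_cE, @cED, @cEB, @cEN, @cEZ, @cE0, @sum_cE).

Lemma measurable_cts {R : realType} {X : ptopologicalType} (f : C R X) :
  measurable_fun [set: borel X] (f : borel X -> R).
Proof.
apply: (measurability _ (RGenOpens.measurableE R)).
move=> _ [_ [a [b ->] <-]]; rewrite setTI; apply: sub_sigma_algebra.
apply: open_comp => [x _|]; first exact: cts_fun.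
exact: interval_open.
Qed.

Lemma borel_open {X : ptopologicalType} (U : set X) :
  open U -> measurable (U : set (borel X)).
Proof. by move=> oU; exact: sub_sigma_algebra. Qed.

Lemma borel_closed {X : ptopologicalType} (F : set X) :
  closed F -> measurable (F : set (borel X)).
Proof.
move=> cF; rewrite -(setCK F); apply: measurableC; apply: borel_open.
exact: closed_openC.
Qed.

Lemma integrable_indic_fin d (T : measurableType d) (R : realType)
    (mu : {finite_measure set T -> \bar R}) A : measurable A ->
  mu.-integrable [set: T] (EFin \o (\1_A : T -> R)).
Proof.
move=> mA; apply: measurable_bounded_integrable => //.
- by rewrite -ge0_fin_numE// fin_num_measure.
- exists 1; split; first exact: num_real.
  move=> M M1 x _; apply: le_trans (ltW M1).
  by rewrite indicE; case: (_ \in _); rewrite ?normr1 ?normr0.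
Qed.

Section integral_cts.
Context {R : realType} {X : compactMetricType R}.
Variable mu : {finite_measure set (borel X) -> \bar R}.
Implicit Types f g : C R X.

Lemma integrable_cts f : mu.-integrable [set: borel X] (EFin \o f).
Proof.
apply: measurable_bounded_integrable => //.
- by rewrite -ge0_fin_numE// fin_num_measure.
- exact: measurable_cts.
- exists (sup_norm f); split; first exact: num_real.
  by move=> M fM x _; apply: le_trans (sup_norm_ge f x) _; exact: ltW.
Qed.

Lemma int_ctsD f g : \int[mu]_x (f + g) x = \int[mu]_x f x + \int[mu]_x g x.
Proof. by apply: RintegralD => //; exact: integrable_cts. Qed.

Lemma int_ctsZ (r : R) f : \int[mu]_x (r *: f) x = r * \int[mu]_x f x.
Proof. by apply: RintegralZl => //; exact: integrable_cts. Qed.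

Lemma int_ctsB f g : \int[mu]_x (f - g) x = \int[mu]_x f x - \int[mu]_x g x.
Proof. by apply: RintegralB => //; exact: integrable_cts. Qed.

Lemma int_cts0 : \int[mu]_x (0 : C R X) x = 0.
Proof. by rewrite -[0 : C R X](scale0r 0) int_ctsZ mul0r. Qed.

Lemma int_ctsN f : \int[mu]_x (- f) x = - \int[mu]_x f x.
Proof. by rewrite -[- f]sub0r int_ctsB int_cts0 sub0r. Qed.

Lemma int_cts_cst (r : R) : \int[mu]_x cst_c r x = r * fine (mu setT).
Proof.
rewrite -(Rintegral_cst _ measurableT); apply: eq_Rintegral => x _.
by rewrite cst_cE.
Qed.

Lemma le_int_cts f g : (forall x, f x <= g x) ->
  \int[mu]_x f x <= \int[mu]_x g x.
Proof. by move=> fg; apply: le_Rintegral => //; exact: integrable_cts. Qed.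

Lemma int_cts_ge0 f : (forall x, 0 <= f x) -> 0 <= \int[mu]_x f x.
Proof. by move=> f0; exact: Rintegral_ge0. Qed.

Let integrable_scaled_indic (A : set (borel X)) (r : R) : measurable A ->
  mu.-integrable setT (EFin \o (fun x => r * \1_A x)).
Proof.
move=> mA; have iA := integrable_indic_fin mu mA.
exact: (@integrableZl _ _ _ mu setT measurableT r _ iA).
Qed.

Lemma int_cts_le_mu f (A : set (borel X)) (r : R) : measurable A ->
  (forall x, f x <= r * \1_A x) -> \int[mu]_x f x <= r * fine (mu A).
Proof.
move=> mA fA; apply: (@le_trans _ _ (\int[mu]_x (r * \1_A x))).
  apply: le_Rintegral => //; [exact: integrable_cts|exact: integrable_scaled_indic].
rewrite RintegralZl//; last exact: integrable_indic_fin.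
by rewrite /Rintegral integral_indic// setIT.
Qed.

Lemma mu_le_int_cts f (A : set (borel X)) (r : R) : measurable A ->
  (forall x, r * \1_A x <= f x) -> r * fine (mu A) <= \int[mu]_x f x.
Proof.
move=> mA fA; apply: (@le_trans _ _ (\int[mu]_x (r * \1_A x))); last first.
  apply: le_Rintegral => //; [exact: integrable_scaled_indic|exact: integrable_cts].
rewrite RintegralZl//; last exact: integrable_indic_fin.
by rewrite /Rintegral integral_indic// setIT.
Qed.

End integral_cts.

Section metric_functions.
Context {R : realType} {X : compactMetricType R}.

Lemma lipschitz1_continuous (f : X -> R) :
  (forall x y, f x - f y <= mdist x y) -> continuous f.
Proof.
move=> lf x; apply/cvgrPdist_le => e e0.
near=> y.
have xy : mdist x y < e.
  have : ball x e y by near: y; exact: nbhsx_ballx.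
  by rewrite ballEmdist.
rewrite ler_norml lerNl opprB; apply/andP; split.
  by rewrite (le_trans (lf y x))// metric_sym ltW.
exact: le_trans (lf x y) (ltW xy).
Unshelve. all: by end_near. Qed.

(** The distance to the complement; it is 1-Lipschitz as an infimum of distances
    to points. *)
Lemma open_cozero (U : set X) : open U ->
  exists u : C R X, (forall x, 0 <= u x) /\ U = [set x | 0 < u x].
Proof.
move=> oU; have [[y0 Uy0]|U0] := pselect (~` U !=set0); last first.
  exists (cst_c 1); split=> [x|]; first by rewrite cst_cE.
  apply/seteqP; split=> x _; first by rewrite /= cst_cE.
  by apply: contrapT => Ux; apply: U0; exists x.
pose E x := [set mdist x y | y in ~` U].
have Einf x : has_inf (E x).
  split; first by exists (mdist x y0); exists y0.
  by exists 0 => _ [y _ <-]; exact: mdist_ge0.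
have d0 x : 0 <= inf (E x).
  by apply: lb_le_inf => [|_ [y _ <-]]; [exact: (Einf x).1|exact: mdist_ge0].
have dcts : continuous (fun x => inf (E x)).
  apply: lipschitz1_continuous => x y.
  rewrite lerBlDr -lerBlDl; apply: lb_le_inf; first exact: (Einf y).1.
  move=> _ [z Uz <-]; rewrite lerBlDl; apply: le_trans (metric_triangle x y z).
  by apply: ge_inf; [exact: (Einf x).2|exists z].
exists (mkcts dcts); split=> [x|]; first exact: d0.
apply/seteqP; split=> x /=.
  move=> Ux; move: oU; rewrite openE => /(_ _ Ux)/nbhs_ballP[e /= e0 eU].
  apply: lt_le_trans e0 _; apply: lb_le_inf; first exact: (Einf x).1.
  move=> _ [y Uy <-]; rewrite leNgt; apply/negP => xy; apply: Uy; apply: eU.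
  by rewrite ballEmdist.
move=> ux; apply: contrapT => Ux; move: ux; apply/negP; rewrite -leNgt.
by rewrite -(mdistxx x); apply: ge_inf; [exact: (Einf x).2|exists x].
Qed.

End metric_functions.

Section finite_measure_of.
Context d (T : measurableType d) (R : realType) (mu : {measure set T -> \bar R}).

(** An alias carrying the proof of finiteness, so that [mu] with this proof is
    recognised as a finite measure. *)
Definition finite_measure_of (_ : fin_num_fun mu) : set T -> \bar R := mu.

Variable mu_fin : fin_num_fun mu.

HB.instance Definition _ := isMeasure.Build _ T R (finite_measure_of mu_fin)
  (measure0 mu) (measure_ge0 mu) (@measure_semi_sigma_additive _ _ _ mu).

HB.instance Definition _ :=
  Measure_isFinite.Build _ T R (finite_measure_of mu_fin) mu_fin.

End finite_measure_of.

(** * The Riesz representation theorem *)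

Lemma nneseries_pair : exists e : nat -> nat * nat,
  forall (R : realType) (a : nat -> nat -> \bar R), (forall i j, 0 <= a i j)%E ->
  (\sum_(k <oo) a (e k).1 (e k).2 = \sum_(i <oo) \sum_(j <oo) a i j)%E.
Proof.
have /card_esym/ppcard_eqP[f] := card_nat2.
exists f => R a a0; pose b (p : nat * nat) := a p.1 p.2.
have -> : (\sum_(k <oo) a (f k).1 (f k).2 = \esum_(k in [set: nat]) b (f k))%E.
  by apply: nneseries_esumT => k; exact: a0.
rewrite -(reindex_esum [set: nat] [set: nat * nat] f b) ; last exact: bij.
rewrite nneseries_esumT => [|i]; last by apply: nneseries_ge0 => j _ _.
under [RHS]eq_esum do rewrite nneseries_esumT//.
rewrite esum_esum//.
by congr esum; apply/seteqP; split.
Qed.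

Lemma nneseries_ge_partial {R : realType} (u : nat -> \bar R) n :
  (forall k, 0 <= u k)%E -> (\sum_(0 <= k < n) u k <= \sum_(k <oo) u k)%E.
Proof.
move=> u0; apply: nneseries_lim_ge => k *; exact: u0.
Qed.

Lemma nneseries_ge_term {R : realType} (u : nat -> \bar R) i :
  (forall k, 0 <= u k)%E -> (u i <= \sum_(k <oo) u k)%E.
Proof.
move=> u0; apply: le_trans (nneseries_ge_partial i.+1 u0).
by rewrite big_nat_recr//= leeDr// sume_ge0.
Qed.

Section riesz.
Context {R : realType} {X : compactMetricType R}.
Variable lam : {scalar C R X}.
Hypothesis lam_ge0 : forall f : C R X, (forall x, 0 <= f x) -> 0 <= lam f.
Implicit Types f g h : C R X.

Let lam_le f g : (forall x, f x <= g x) -> lam f <= lam g.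
Proof.
move=> fg; rewrite -subr_ge0 -raddfB; apply: lam_ge0 => x.
by rewrite cEB subr_ge0.
Qed.

Let lam1_ge0 : 0 <= lam (cst_c 1).
Proof. by apply: lam_ge0 => x; rewrite cE. Qed.

(** Dini's argument: by compactness finitely many terms already exceed [g] up to
    a small constant, and [lam] is monotone. This is where positivity yields
    countable additivity. *)
Lemma positive_functional_le_series (f : nat -> C R X) g :
  (forall n x, 0 <= f n x) ->
  (forall x, (g x)%:E <= \sum_(n <oo) (f n x)%:E)%E ->
  ((lam g)%:E <= \sum_(n <oo) (lam (f n))%:E)%E.
Proof.
move=> f0 gf; apply/lee_addgt0Pr => e e0.
set c := lam (cst_c 1); pose d := e / (c + 1).
have c1 : 0 < c + 1 by rewrite ltr_wpDl.
have d0 : 0 < d by rewrite divr_gt0.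
have [N _ /(_ N (leqnn N)) gN] : \forall n \near \oo,
    [set: X] `<=` (fun x => g x - d <= \sum_(0 <= i < n) f i x).
  apply: ((compact_near_coveringP [set: X]).1 compact_setT nat \oo
    (fun n x => g x - d <= \sum_(0 <= i < n) f i x) _) => x _.
  have [N xN] : exists N, g x - d < \sum_(0 <= i < N) f i x.
    apply: contrapT => /forallNP h.
    have : (\sum_(n <oo) (f n x)%:E <= (g x - d)%:E)%E.
      apply: lime_le; first by apply: is_cvg_nneseries => n *; rewrite lee_fin.
      by apply: nearW => n; rewrite sumEFin lee_fin leNgt; apply/negP/h.
    move/(le_trans (gf x)); rewrite lee_fin; lra.
  exists ([set y | 0 < (\sum_(0 <= i < N) f i - (g - cst_c d)) y], [set n | (N <= n)%N]) => /=.
    split; last by exists N.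
    apply: open_nbhs_nbhs; split; last by rewrite /= !cE subr_gt0.
    exact: (open_comp (fun y _ => cts_fun _) (@open_gt R 0)).
  move=> [y n] /= [+ Nn]; rewrite !cE subr_gt0 => /ltW/le_trans; apply.
  rewrite (big_cat_nat (leq0n N) Nn)//= lerDl sumr_ge0// => i _; exact: f0.
apply: (@le_trans _ _ (lam (\sum_(0 <= i < N) f i) + e)%:E).
  rewrite lee_fin -lerBlDr; apply: (@le_trans _ _ (lam (g - cst_c d))).
    rewrite raddfB/= lerD2l lerN2.
    have -> : cst_c d = d *: cst_c 1 :> C R X.
      by apply/continuousEP => x; rewrite !cE mulr1.
    rewrite linearZ/= -/c /d -mulrA ler_piMr ?(ltW e0)//.
    by rewrite mulrC ler_pdivrMr// mul1r lerDl.
  by apply: lam_le => x; rewrite !cE; exact: gN.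
rewrite EFinD leeD2r// raddf_sum -sumEFin.
by apply: nneseries_ge_partial => k; rewrite lee_fin lam_ge0.
Qed.

(** Countable families of continuous functions play the role of coverings; the
    outer measure of a set is the cheapest value of [lam] on a family whose sum
    dominates the indicator function of the set. *)
Definition riesz_cover (A : set X) : set (nat -> C R X) :=
  [set f | (forall n x, 0 <= f n x) /\
           (forall x, A x -> 1 <= \sum_(n <oo) (f n x)%:E)%E].

Definition riesz_outer (A : set X) : \bar R :=
  ereal_inf [set (\sum_(n <oo) (lam (f n))%:E)%E | f in riesz_cover A].

Let lam_series_ge0 (f : nat -> C R X) : (forall n x, 0 <= f n x) ->
  (0 <= \sum_(n <oo) (lam (f n))%:E)%E.
Proof. by move=> f0; apply: nneseries_ge0 => n _ _; rewrite lee_fin lam_ge0. Qed.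

Lemma riesz_outer_ge0 A : (0 <= riesz_outer A)%E.
Proof. by apply: le_ereal_inf_tmp => _ [f [f0 _] <-]; exact: lam_series_ge0. Qed.

Lemma riesz_outer_le A (f : nat -> C R X) : riesz_cover A f ->
  (riesz_outer A <= \sum_(n <oo) (lam (f n))%:E)%E.
Proof. by move=> Af; apply: ereal_inf_lbound; exists f. Qed.

Lemma riesz_outer0 : riesz_outer set0 = 0%E.
Proof.
apply/eqP; rewrite eq_le riesz_outer_ge0 andbT.
apply: le_trans (riesz_outer_le (f := fun=> 0) _) _; first by split.
by rewrite eseries0// => n _ _; rewrite raddf0.
Qed.

Lemma riesz_outer_sub A (F : (set X)^nat) : A `<=` \bigcup_n F n ->
  (riesz_outer A <= \sum_(n <oo) riesz_outer (F n))%E.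
Proof.
move=> AF; have [[i ioo]|] := pselect (exists i, riesz_outer (F i) = +oo%E).
  rewrite (eseries_pinfty _ _ ioo) ?leey// => n _.
  by rewrite -ltNye (lt_le_trans _ (riesz_outer_ge0 _)).
rewrite -forallNE => Foo; apply/lee_addgt0Pr => e e0.
apply: le_trans (epsilon_trick _ _ (ltW e0)); last first.
  by move=> n; exact: riesz_outer_ge0.
have /choice[f fP] n : exists f : nat -> C R X, riesz_cover (F n) f /\
    (\sum_(k <oo) (lam (f k))%:E <= riesz_outer (F n) + (e / (2 ^ n.+1)%:R)%:E)%E.
  have en : 0 < e / (2 ^ n.+1)%:R by rewrite divr_gt0.
  have fin : riesz_outer (F n) \is a fin_num.
    by rewrite ge0_fin_numE ?riesz_outer_ge0// ltey; exact/eqP/Foo.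
  have [_ [f Ff <-] /ltW fe] := lb_ereal_inf_adherent en fin.
  by exists f.
have f0 n k x : 0 <= f n k x by have [[]] := fP n.
have [b bP] := nneseries_pair.
apply: le_trans (riesz_outer_le (f := fun k => f (b k).1 (b k).2) _) _.
  split=> [n x|x Ax]; first exact: f0.
  rewrite (bP _ (fun i j => (f i j x)%:E)); last by move=> i j; rewrite lee_fin f0.
  have [i _ Fix_] := AF x Ax.
  apply: le_trans ((fP i).1.2 x Fix_) _.
  apply: (@nneseries_ge_term _ (fun i => \sum_(j <oo) (f i j x)%:E)%E i) => k.
  by apply: nneseries_ge0 => *; rewrite lee_fin f0.
rewrite (bP _ (fun i j => (lam (f i j))%:E)); last first.
  by move=> i j; rewrite lee_fin lam_ge0// => x; exact: f0.
apply: lee_nneseries => [n *|n _]; last by have [] := fP n.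
by apply: lam_series_ge0 => k x; exact: f0.
Qed.

HB.instance Definition _ := @isSubsetOuterMeasure.Build R X riesz_outer
  riesz_outer0 riesz_outer_ge0 riesz_outer_sub.

(** The continuous functions [w k = min(1, k u)] increase to the indicator
    function of [{u > 0}]. If a family [f] covers [A], then multiplying it by the
    increments [v j] of [w] covers the part of [A] in [{u > 0}], and
    multiplying it by [1 - w k] covers the rest. The total cost of the two
    families, the first one cut at [j < k], is that of [f]. *)
Lemma riesz_outer_caratheodory (u : C R X) : (forall x, 0 <= u x) ->
  caratheodory_measurable riesz_outer [set x | 0 < u x].
Proof.
move=> u0; apply: le_caratheodory_measurable => A; set U := [set x | 0 < u x].
apply: le_ereal_inf_tmp => _ [f [f0 fA] <-].
pose w k := min_c (cst_c 1) (k%:R *: u).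
pose v j := w j.+1 - w j.
have wE k x : w k x = Num.min 1 (k%:R * u x) by rewrite min_cE cst_cE.
have w_le1 k x : w k x <= 1 by rewrite wE ge_min lexx.
have w_ge0 k x : 0 <= w k x by rewrite wE le_min ler01 mulr_ge0.
have v_ge0 j x : 0 <= v j x.
  rewrite cEB subr_ge0 !wE le_min ge_min lexx/= ge_min.
  by apply/orP; right; rewrite ler_wpM2r// ler_nat.
have sumv k : \sum_(0 <= j < k) v j = w k.
  rewrite telescope_sumr//; apply/continuousEP => x.
  by rewrite cEB [w 0%N x]wE mul0r min_r// subr0.
pose a j := (\sum_(n <oo) (lam (mul_c (f n) (v j)))%:E)%E.
have fv0 n j : (0 <= (lam (mul_c (f n) (v j)))%:E)%E.
  by rewrite lee_fin lam_ge0// => x; rewrite cE mulr_ge0.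
have hU : (riesz_outer (A `&` U) <= \sum_(j <oo) a j)%E.
  have [b bP] := nneseries_pair.
  rewrite /a -(bP _ (fun j n => (lam (mul_c (f n) (v j)))%:E))//.
  apply: (@riesz_outer_le _ (fun k => mul_c (f (b k).2) (v (b k).1))).
  split=> [k x|x [Ax Ux]]; first by rewrite cE mulr_ge0.
  rewrite (bP _ (fun j n => (mul_c (f n) (v j) x)%:E)); last first.
    by move=> i j; rewrite lee_fin cE mulr_ge0.
  apply: (@le_trans _ _ (\sum_(j <oo) (v j x)%:E)%E); last first.
    apply: lee_nneseries => [j _ _|j _]; first by rewrite lee_fin.
    under eq_eseriesr do rewrite cE mulrC EFinM.
    rewrite nneseriesZl; last by move=> *; rewrite lee_fin.
    by rewrite lee_pemulr// ?lee_fin// fA.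
  pose k := (Num.truncn (u x)^-1).+1.
  apply: le_trans (nneseries_ge_partial k _); last by move=> *; rewrite lee_fin.
  rewrite sumEFin -sum_cE sumv lee_fin wE le_min lexx/=.
  rewrite -ler_pdivrMr// mul1r; apply/ltW; rewrite truncnS_gt//.
have hC k : (riesz_outer (A `&` ~` U) + \sum_(0 <= j < k) a j <=
    \sum_(n <oo) (lam (f n))%:E)%E.
  have -> : (\sum_(0 <= j < k) a j =
      \sum_(n <oo) (lam (mul_c (f n) (w k)))%:E)%E.
    rewrite -nneseries_sum_nat//; apply: eq_eseriesr => n _.
    rewrite sumEFin -raddf_sum; congr (lam _)%:E; apply/continuousEP => x.
    by rewrite sum_cE cE -sumv sum_cE mulr_sumr.
  apply: (@le_trans _ _ (\sum_(n <oo) (lam (mul_c (f n) (cst_c 1 - w k)))%:E +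
      \sum_(n <oo) (lam (mul_c (f n) (w k)))%:E)%E).
    rewrite leeD2r//; apply: riesz_outer_le; split=> [n x|x [Ax /negP nUx]].
      by rewrite mul_cE mulr_ge0// cEB cst_cE subr_ge0.
    have -> : (\sum_(n <oo) (mul_c (f n) (cst_c 1 - w k) x)%:E =
        \sum_(n <oo) (f n x)%:E)%E; last exact: fA.
      apply: eq_eseriesr => n _; rewrite mul_cE cEB cst_cE.
      have -> : w k x = 0; last by rewrite subr0 mulr1.
      rewrite wE.
      suff -> : u x = 0 by rewrite mulr0 min_r.
      by apply/eqP; rewrite eq_le u0 andbT leNgt.
  rewrite -nneseriesD.
  - rewrite le_eqVlt; apply/predU1P; left; apply: eq_eseriesr => n _; rewrite -EFinD -raddfD; congr (lam _)%:E.
    by apply/continuousEP => x; rewrite cED !mul_cE cEB cst_cE -mulrDr subrK mulr1.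
  - move=> n _ _; rewrite lee_fin lam_ge0// => x.
    by rewrite mul_cE mulr_ge0// cEB cst_cE subr_ge0 w_le1.
  - by move=> n _ _; rewrite lee_fin lam_ge0// => x; rewrite mul_cE mulr_ge0.
have [Soo|] := eqVneq (\sum_(n <oo) (lam (f n))%:E)%E +oo%E.
  by rewrite Soo leey.
rewrite -ltey => Sfin.
have Cfin : riesz_outer (A `&` ~` U) \is a fin_num.
  rewrite ge0_fin_numE ?riesz_outer_ge0//; apply: le_lt_trans Sfin.
  by have := hC 0%N; rewrite big_geq// adde0.
apply: le_trans (leeD2r _ hU) _; rewrite addeC -leeBrDl//.
apply: lime_le; first by apply: is_cvg_nneseries => n *; exact: nneseries_ge0.
by apply: nearW => k; rewrite leeBrDl.
Qed.

Let outer_setT : riesz_outer setT = (lam (cst_c 1))%:E.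
Proof.
(* the covering by the single function 1 is optimal, by Dini's argument *)
pose f n : C R X := if n is 0%N then cst_c 1 else 0.
have f0 n x : 0 <= f n x by case: n => [|n]; rewrite ?cst_cE// cE0.
have sumf (g : C R X -> R) : g 0 = 0 -> (forall n, 0 <= g (f n)) ->
    (\sum_(n <oo) (g (f n))%:E)%E = (g (cst_c 1))%:E.
  move=> g0 gf0; rewrite nneseries_recl//; last by move=> n _; rewrite lee_fin.
  rewrite /= eseries0 ?adde0// => -[|n] // _ _ /=.
  by rewrite g0.
apply/eqP; rewrite eq_le; apply/andP; split.
  have -> : (lam (cst_c 1))%:E = (\sum_(n <oo) (lam (f n))%:E)%E.
    by rewrite (sumf lam) ?raddf0// => n; exact: lam_ge0.
  apply: riesz_outer_le; split=> // x _.
  by rewrite (sumf (fun g => g x))// cst_cE.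
apply: le_ereal_inf_tmp => _ [g [g0 gA] <-].
apply: positive_functional_le_series => // x.
by rewrite cst_cE; exact: gA.
Qed.

Let borel_caratheodory (A : set (borel X)) : measurable A ->
  caratheodory_measurable riesz_outer A.
Proof.
move: A; apply: smallest_sub => [|U oU].
  split.
  - exact: caratheodory_measurable_set0.
  - move=> A mA; rewrite setTD; exact: caratheodory_measurable_setC.
  - exact: caratheodory_measurable_bigcup.
have [u [u0 ->]] := open_cozero oU.
exact: riesz_outer_caratheodory.
Qed.

(** Cutting [f >= 0] into horizontal slices of height [e], each slice is at most
    [e] times the indicator function of its base, which lies in the top level of
    the slice below; hence the integral of [f] exceeds [lam f] by at most the
    cost of the first slice, and [\int f <= lam f]. As both sides agree on
    constants, this inequality for [sup_norm f + f] and [sup_norm f - f] gives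
    equality for every [f]. *)
Theorem riesz_representation : exists mu : {finite_measure set (borel X) -> \bar R},
  forall f, \int[mu]_x f x = lam f.
Proof.
pose m : set (borel X) -> \bar R := riesz_outer.
have m_sigma : semi_sigma_additive m.
  move=> F mF tF mbF.
  apply: (@caratheodory_measure_sigma_additive R X riesz_outer) => // [n|].
    exact: borel_caratheodory.
  exact: borel_caratheodory.
pose mu1 : {measure set (borel X) -> \bar R} :=
  HB.pack m (isMeasure.Build _ (borel X) R m riesz_outer0 riesz_outer_ge0 m_sigma).
have mu_fin : fin_num_fun mu1.
  move=> A mA; rewrite ge0_fin_numE//.
  apply: le_lt_trans (_ : (riesz_outer setT < +oo)%E).
    exact: le_outer_measure.
  by rewrite outer_setT ltry.
pose mu : {finite_measure set (borel X) -> \bar R} := finite_measure_of mu_fin.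
exists mu.
have muT : fine (mu setT) = lam (cst_c 1) by rewrite [mu setT]outer_setT.
(* [e^-1 * min(f, e)] is at least 1 on the level set, so it covers it *)
have mu_level f (e : R) : 0 < e -> (forall x, 0 <= f x) ->
    e * fine (mu [set x : borel X | e <= f x]) <= lam (min_c f (cst_c e)).
  move=> e0 f0; rewrite -ler_pdivlMl// -lee_fin fineK; last first.
    apply: fin_num_measure; apply: borel_closed.
    exact: (closed_comp (fun y _ => cts_fun _) (@closed_ge R e)).
  pose g n : C R X := if n is 0%N then e^-1 *: min_c f (cst_c e) else 0.
  have g0 n x : 0 <= g n x.
    case: n => [|n]; rewrite ?cE0// cEZ min_cE cst_cE mulr_ge0 ?invr_ge0 ?(ltW e0)//.
    by rewrite le_min f0 ltW.
  have sumg (h : C R X -> R) : h 0 = 0 -> (forall n, 0 <= h (g n)) ->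
      (\sum_(n <oo) (h (g n))%:E)%E = (h (g 0%N))%:E.
    move=> h0 hg0; rewrite nneseries_recl//; last by move=> n _; rewrite lee_fin.
    rewrite /= eseries0 ?adde0// => -[|n] // _ _ /=.
    by rewrite h0.
  have -> : (e^-1 * lam (min_c f (cst_c e)))%:E = (\sum_(n <oo) (lam (g n))%:E)%E.
    rewrite (sumg lam) ?raddf0//; last by move=> n; exact: lam_ge0.
    by rewrite /g linearZ.
  apply: riesz_outer_le; split=> // x /= efx.
  by rewrite (sumg (fun h => h x))// cEZ min_cE cst_cE min_r// mulVf ?gt_eqF.
(* induction on the number of slices; [f - min(f, e)] has one slice less *)
have slice (e : R) (N : nat) : 0 < e -> forall f, (forall x, 0 <= f x <= N%:R * e) ->
    \int[mu]_x (f - min_c f (cst_c e)) x <= lam f.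
  move=> e0; elim: N => [|N IHN] f fN.
    have -> : f = 0.
      apply/continuousEP => x; have := fN x; rewrite mul0r.
      by rewrite -eq_le => /eqP <-; rewrite cE0.
    rewrite raddf0 (le_trans (@le_int_cts _ _ mu _ 0 _))//.
      by move=> x; rewrite cEB min_cE cst_cE cE0 min_l ?subrr// ltW.
    by rewrite int_cts0.
  have f0 x : 0 <= f x by have /andP[] := fN x.
  pose g := f - min_c f (cst_c e).
  have gE x : g x = f x - Num.min (f x) e by rewrite cEB min_cE cst_cE.
  have g0 x : 0 <= g x by rewrite gE subr_ge0 ge_min lexx.
  have gN x : 0 <= g x <= N%:R * e.
    rewrite g0/= gE; have /andP[_] := fN x.
    rewrite -natr1 mulrDl mul1r => fx.
    have [fe|fe] := leP (f x) e; first by rewrite subrr mulr_ge0// ltW.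
    by rewrite lerBlDr.
  have -> : \int[mu]_x g x = \int[mu]_x (g - min_c g (cst_c e)) x +
      \int[mu]_x (min_c g (cst_c e)) x by rewrite -int_ctsD subrK.
  have -> : lam f = lam g + lam (min_c f (cst_c e)) by rewrite -raddfD subrK.
  apply: lerD; first exact: IHN.
  apply: le_trans (mu_level f e e0 f0); apply: int_cts_le_mu.
  - apply: borel_closed.
    exact: (closed_comp (fun y _ => cts_fun _) (@closed_ge R e)).
  - move=> x; rewrite min_cE cst_cE gE indicE; case: (boolP (x \in _)) => [_|].
      by rewrite mulr1 ge_min lexx orbT.
    rewrite notin_setE/= => /negP; rewrite -ltNge => fe.
    by rewrite mulr0 (min_l (ltW fe)) subrr (min_l (ltW e0)).
have int_le f : (forall x, 0 <= f x) -> \int[mu]_x f x <= lam f.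
  move=> f0; apply/ler_addgt0Pr => e e0.
  pose c := fine (mu setT); have c0 : 0 <= c by rewrite fine_ge0.
  pose d := e / (c + 1); have d0 : 0 < d by rewrite divr_gt0// ltr_wpDl.
  have -> : \int[mu]_x f x = \int[mu]_x (f - min_c f (cst_c d)) x +
      \int[mu]_x (min_c f (cst_c d)) x by rewrite -int_ctsD subrK.
  apply: lerD.
    apply: (slice d (Num.truncn (sup_norm f / d)).+1 d0) => x; rewrite f0/=.
    rewrite -ler_pdivrMr//; apply/ltW/(le_lt_trans _ (truncnS_gt _)).
    rewrite ler_pM2r ?invr_gt0//; apply: le_trans (sup_norm_ge f x).
    exact: ler_norm.
  apply: (@le_trans _ _ (\int[mu]_x cst_c d x)).
    by apply: le_int_cts => x; rewrite min_cE ge_min lexx orbT.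
  rewrite int_cts_cst -/c /d -mulrA ler_piMr ?(ltW e0)//.
  by rewrite mulrC ler_pdivrMr ?mul1r ?lerDl// ltr_wpDl.
move=> f; pose s := cst_c (sup_norm f) : C R X.
have lams : lam s = \int[mu]_x s x.
  rewrite int_cts_cst muT (_ : s = sup_norm f *: cst_c 1) ?linearZ//.
  by apply/continuousEP => x; rewrite [RHS]cEZ /s !cst_cE mulr1.
have fs x : - sup_norm f <= f x <= sup_norm f by rewrite -ler_norml sup_norm_ge.
apply/eqP; rewrite eq_le; apply/andP; split.
  have := int_le (s + f); rewrite int_ctsD linearD lams lerD2l; apply => x.
  by have /andP[+ _] := fs x; rewrite cED /s cst_cE -lerBlDl sub0r.
have := int_le (s - f); rewrite int_ctsB linearB lams lerD2l lerN2; apply => x.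
by have /andP[_] := fs x; rewrite cEB /s cst_cE subr_ge0.
Qed.

End riesz.

(** * The pairing of functions and signed measures *)

Section integral_of_measures.
Context {R : realType} {X : compactMetricType R}.
Implicit Types (m : {finite_measure set (borel X) -> \bar R}) (f g : C R X).

Lemma eq_int_cts_measure m1 m2 f : (forall A, measurable A -> m1 A = m2 A) ->
  \int[m1]_x f x = \int[m2]_x f x.
Proof. by move=> m12; congr fine; apply: eq_measure_integral => A mA _; exact: m12. Qed.

Let measure_add_fin m1 m2 : fin_num_fun (measure_add m1 m2).
Proof. by move=> A mA; rewrite measure_addE fin_numD !fin_num_measure. Qed.

Definition finite_measure_add m1 m2 : {finite_measure set (borel X) -> \bar R} :=
  finite_measure_of (@measure_add_fin m1 m2).

Lemma finite_measure_addE m1 m2 A : finite_measure_add m1 m2 A = (m1 A + m2 A)%E.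
Proof. exact: measure_addE. Qed.

Lemma int_cts_measure_add m1 m2 f :
  \int[finite_measure_add m1 m2]_x f x = \int[m1]_x f x + \int[m2]_x f x.
Proof.
apply: EFin_inj.
rewrite EFinD /Rintegral !fineK; try (apply: integrable_fin_num => //; exact: integrable_cts).
by apply: integral_measure_add => //; exact: integrable_cts.
Qed.

(** Adding a constant reduces the claim to nonnegative functions. *)
Lemma int_cts_mscale m (k : {nonneg R}) f :
  \int[mscale k m]_x f x = k%:num * \int[m]_x f x.
Proof.
wlog f0 : f / forall x, 0 <= f x => [h|].
  have /h : forall x, 0 <= (f + cst_c (sup_norm f)) x.
    move=> x; rewrite cED cst_cE addrC -lerBlDl sub0r.
    by have := sup_norm_ge f x; rewrite ler_norml => /andP[].
  have /h : forall x, 0 <= (cst_c (sup_norm f) : C R X) x.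
    by move=> x; rewrite cst_cE (le_trans _ (sup_norm_ge f point)).
  by rewrite !int_ctsD => -> /eqP; rewrite mulrDr (inj_eq (addIr _)) => /eqP.
rewrite /Rintegral ge0_integral_mscale//.
- by rewrite fineM//; exact/integrable_fin_num/integrable_cts.
- exact: measurable_int (integrable_cts m f).
- by move=> x _; rewrite lee_fin.
Qed.

End integral_of_measures.

Section pairing_theory.
Context {R : realType} {X : compactMetricType R}.
Implicit Types (m : {finite_measure set (borel X) -> \bar R}).
Implicit Types (f g : C R X) (mu nu : M R X).

Definition measure_M m : M R X := M_of (charge_of_finite_measure m).

Lemma measure_ME m A : measurable A -> measure_M m A = m A.
Proof. by move=> mA; rewrite M_ofE. Qed.

(** The positive set [P] is part of the conclusion because it shows below that
    invariance passes to the two parts. *)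
Lemma hahn_M nu : exists (P : set (borel X)) m1 m2, [/\ measurable P,
  forall A, measurable A -> m1 A = nu (A `&` P),
  forall A, measurable A -> m2 A = (- nu (A `&` ~` P))%E &
  forall A, measurable A -> nu A = (m1 A - m2 A)%E].
Proof.
have [P [N nuPN]] := Hahn_decomposition nu.
have [[mP _] [mN _] PN PN0] := nuPN.
have NP : N = ~` P.
  apply/seteqP; split=> x; last first.
    by move=> nP; have [] : (P `|` N) x by rewrite PN.
  by move=> Nx Px; have : (P `&` N) x by []; rewrite PN0.
exists P, (jordan_pos nuPN), (jordan_neg nuPN); split => // A mA.
- by rewrite -[LHS]/(crestr0 nu mP A) /crestr0 mem_set.
- by rewrite -[LHS]/(cscale (-1) (crestr0 nu mN) A) cscaleN1/= /crestr0 mem_set// /crestr NP.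
- by rewrite (jordan_decomp nuPN mA) /cadd/= cscaleN1.
Qed.

(** Independence of the decomposition: two decompositions become an equality of
    sums of measures. Bilinearity of the pairing follows. *)
Lemma pairing_diff nu m1 m2 : (forall A, measurable A -> nu A = m1 A - m2 A)%E ->
  forall f, pairing f nu = \int[m1]_x f x - \int[m2]_x f x.
Proof.
move=> nuE f; rewrite /pairing /integralM.
move: (projT2 (cid (projT2 (cid (Hahn_decomposition nu))))) => nuPN.
pose jp : {finite_measure set (borel X) -> \bar R} := jordan_pos nuPN.
pose jn : {finite_measure set (borel X) -> \bar R} := jordan_neg nuPN.
change (\int[jp]_x f x - \int[jn]_x f x = \int[m1]_x f x - \int[m2]_x f x).
suff : \int[jp]_x f x + \int[m2]_x f x = \int[m1]_x f x + \int[jn]_x f x.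
  by move=> h; apply/eqP; rewrite subr_eq addrAC -h addrK.
rewrite -!int_cts_measure_add; apply: eq_int_cts_measure => A mA.
rewrite !finite_measure_addE.
have : (m1 A - m2 A = jp A - jn A)%E.
  by rewrite -nuE// (jordan_decomp nuPN mA) /cadd/= cscaleN1.
have E (m : {finite_measure set (borel X) -> \bar R}) : m A = (fine (m A))%:E.
  by rewrite fineK// fin_num_measure.
rewrite (E m1) (E m2) (E jp) (E jn) => -[abcd].
by rewrite -!EFinD; congr EFin; lra.
Qed.

Lemma pairing_measure m f : pairing f (measure_M m) = \int[m]_x f x.
Proof.
rewrite (@pairing_diff _ m mzero) => [|A mA].
  by rewrite /Rintegral integral_measure_zero subr0.
by rewrite measure_ME// /mzero sube0.
Qed.

Lemma pairingDl f g nu : pairing (f + g) nu = pairing f nu + pairing g nu.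
Proof.
have [_ [m1 [m2 [_ _ _ nuE]]]] := hahn_M nu.
by rewrite !(pairing_diff nuE) !int_ctsD; lra.
Qed.

Lemma pairingZl (r : R) f nu : pairing (r *: f) nu = r * pairing f nu.
Proof.
have [_ [m1 [m2 [_ _ _ nuE]]]] := hahn_M nu.
by rewrite !(pairing_diff nuE) !int_ctsZ; lra.
Qed.

Lemma pairingNl f nu : pairing (- f) nu = - pairing f nu.
Proof. by rewrite -scaleN1r pairingZl mulN1r. Qed.

Lemma pairingBl f g nu : pairing (f - g) nu = pairing f nu - pairing g nu.
Proof. by rewrite pairingDl pairingNl. Qed.

Lemma pairing0l nu : pairing 0 nu = 0.
Proof. by rewrite -(scale0r (0 : C R X)) pairingZl mul0r. Qed.

Lemma pairingDr f mu nu : pairing f (mu + nu) = pairing f mu + pairing f nu.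
Proof.
have [_ [m1 [m2 [_ _ _ muE]]]] := hahn_M mu.
have [_ [n1 [n2 [_ _ _ nuE]]]] := hahn_M nu.
rewrite (pairing_diff muE) (pairing_diff nuE).
rewrite (@pairing_diff _ (finite_measure_add m1 n1) (finite_measure_add m2 n2)).
  by rewrite !int_cts_measure_add; lra.
move=> A mA; rewrite !finite_measure_addE MED// muE// nuE//.
have E (m : {finite_measure set (borel X) -> \bar R}) : m A = (fine (m A))%:E.
  by rewrite fineK// fin_num_measure.
rewrite (E m1) (E m2) (E n1) (E n2).
by rewrite -!(EFinN, EFinD); congr EFin; lra.
Qed.

Lemma pairingZr (r : R) f nu : pairing f (r *: nu) = r * pairing f nu.
Proof.
have [_ [m1 [m2 [_ _ _ nuE]]]] := hahn_M nu.
have [r0|r0] := leP 0 r.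
  pose k := NngNum r0.
  rewrite (pairing_diff nuE) (@pairing_diff _ (mscale k m1) (mscale k m2)).
    by rewrite !int_cts_mscale/=; lra.
  move=> A mA; rewrite MEZ// nuE//.
  change (r%:E * (m1 A - m2 A) = r%:E * m1 A - r%:E * m2 A)%E.
  have E (m : {finite_measure set (borel X) -> \bar R}) : m A = (fine (m A))%:E.
    by rewrite fineK// fin_num_measure.
  by rewrite (E m1) (E m2) -!(EFinN, EFinM, EFinD); congr EFin; lra.
have r0' : 0 <= - r by rewrite oppr_ge0 ltW.
pose k := NngNum r0'.
rewrite (pairing_diff nuE) (@pairing_diff _ (mscale k m2) (mscale k m1)).
  by rewrite !int_cts_mscale/=; lra.
move=> A mA; rewrite MEZ// nuE//.
change (r%:E * (m1 A - m2 A) = (- r)%:E * m2 A - (- r)%:E * m1 A)%E.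
have E (m : {finite_measure set (borel X) -> \bar R}) : m A = (fine (m A))%:E.
  by rewrite fineK// fin_num_measure.
by rewrite (E m1) (E m2) -!(EFinN, EFinM, EFinD); congr EFin; lra.
Qed.

Lemma pairingNr f nu : pairing f (- nu) = - pairing f nu.
Proof. by rewrite -scaleN1r pairingZr mulN1r. Qed.

Lemma pairingBr f mu nu : pairing f (mu - nu) = pairing f mu - pairing f nu.
Proof. by rewrite pairingDr pairingNr. Qed.

Lemma pairing0r f : pairing f (0 : M R X) = 0.
Proof. by rewrite -(scale0r (0 : M R X)) pairingZr mul0r. Qed.

(** A Urysohn function between a closed set inside [A] and an open set around
    [A] approximates the indicator function of [A] for both measures at once, by
    regularity of their sum. *)
Lemma finite_measure_ext m1 m2 : (forall f, \int[m1]_x f x = \int[m2]_x f x) ->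
  forall A, measurable A -> m1 A = m2 A.
Proof.
move=> m12 A mA.
have mfin m : m A = (fine (m A))%:E by rewrite fineK// fin_num_measure.
rewrite (mfin m1) (mfin m2); congr EFin; apply/eqP; rewrite -subr_eq0 -normr_le0.
apply/ler_addgt0Pl => e e0; rewrite addr0.
pose m := finite_measure_add m1 m2.
have mT : (m setT < +oo)%E by rewrite -ge0_fin_numE// fin_num_measure.
have [F [U [cF oU FA AU UF]]] := finite_borel_measure_regular mT mA e0.
have mF := borel_closed cF; have mU := borel_open oU.
have mUF : measurable (U `\` F : set (borel X)) by exact: measurableD.
have FU0 : F `&` ~` U = set0.
  by rewrite -subset0 => x [/FA/AU].
have [f [fcts f01 f0 f1]] := (uniform_separatorP (R := R) _ _).1
  ((normal_separatorP (R := R)).1 pseudometric_normal _ _ (open_closedC oU) cF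
     (etrans (setIC _ _) FU0)).
pose g : C R X := mkcts fcts.
have close (n : {finite_measure set (borel X) -> \bar R}) :
    `|\int[n]_x g x - fine (n A)| <= fine (n (U `\` F)).
  have -> : fine (n A) = \int[n]_x \1_A x.
    by rewrite /Rintegral integral_indic// setIT.
  have -> : fine (n (U `\` F)) = \int[n]_x \1_(U `\` F) x.
    by rewrite /Rintegral integral_indic// setIT.
  have ig := integrable_cts n g; have iA := integrable_indic_fin n mA.
  have iB : n.-integrable setT (EFin \o (fun x => g x - \1_A x)) by exact: (integrableB measurableT ig iA).
  rewrite -RintegralB//; apply: le_trans (le_normr_Rintegral _ iB) _ => //.
  apply: le_Rintegral => //.
  - exact: integrable_norm iB.
  - exact: integrable_indic_fin.
  move=> x _; rewrite !indicE.
  have /andP[g_ge0 g_le1] : 0 <= g x <= 1.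
    by have := f01 (f x); rewrite /= in_itv/=; apply; exists x.
  have [xU|nxU] := pselect (U x); last first.
    rewrite (_ : g x = 0); last by apply: f0; exists x.
    by rewrite memNset ?subr0 ?normr0//; move=> /AU.
  have [xF|nxF] := pselect (F x).
    rewrite (_ : g x = 1); last by apply: f1; exists x.
    by rewrite mem_set ?subrr ?normr0//; exact: FA.
  rewrite [in leRHS]mem_set//; move: (g x) g_ge0 g_le1 => y y0 y1.
  by case: (x \in A) => /=; rewrite ler_norml; apply/andP; split; lra.
have := close m1; have := close m2; rewrite m12 => h1 h2.
apply: (@le_trans _ _ (fine (m (U `\` F)))); last first.
  by rewrite -lee_fin fineK ?fin_num_measure// ltW.
rewrite finite_measure_addE fineD ?fin_num_measure//.
rewrite -[X in `|X|](subrKA (\int[m2]_x g x)) (le_trans (ler_normD _ _))//.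
by rewrite lerD// distrC.
Qed.

End pairing_theory.

Section duality.
Context {R : realType} {X : compactMetricType R}.
Implicit Types (m : {finite_measure set (borel X) -> \bar R}).
Implicit Types (f g : C R X) (mu nu : M R X).

Lemma pairing_inj mu nu : (forall f, pairing f mu = pairing f nu) -> mu = nu.
Proof.
have [_ [m1 [m2 [_ _ _ muE]]]] := hahn_M mu.
have [_ [n1 [n2 [_ _ _ nuE]]]] := hahn_M nu.
move=> munu; apply: M_ext => A mA; rewrite muE// nuE//.
have : finite_measure_add m1 n2 A = finite_measure_add n1 m2 A.
  apply: finite_measure_ext => // f; rewrite !int_cts_measure_add.
  have := munu f; rewrite (pairing_diff muE) (pairing_diff nuE); lra.
rewrite !finite_measure_addE.
have E m : m A = (fine (m A))%:E by rewrite fineK// fin_num_measure.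
rewrite (E m1) (E m2) (E n1) (E n2) => -[h].
by rewrite -!(EFinN, EFinD); congr EFin; lra.
Qed.

Lemma pairing_delta f x : pairing f (delta R x) = f x.
Proof.
rewrite -[delta R x]/(measure_M _) pairing_measure /Rintegral integral_dirac//.
  by rewrite diracT mul1e.
exact: measurable_int (integrable_cts (@dirac _ (borel X) x R) f).
Qed.

Lemma nonneg_M_measure nu : (forall A, measurable A -> (0 <= nu A)%E) ->
  exists m, forall A, measurable A -> nu A = m A.
Proof.
move=> nu0.
have nu_ge0 A : (0 <= nu A)%E.
  by have [/nu0//|nA] := pselect (measurable A); rewrite M_out.
have fin : fin_num_fun (measure_of_charge nu nu_ge0).
  by move=> A mA; exact: fin_num_measure.
by exists (finite_measure_of fin).
Qed.

Lemma pairing_nonneg nu m : (forall A, measurable A -> nu A = m A) ->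
  forall f, pairing f nu = \int[m]_x f x.
Proof.
move=> num f; rewrite (_ : nu = measure_M m) ?pairing_measure//.
by apply: M_ext => A mA; rewrite measure_ME ?num.
Qed.

Lemma int_cts_norm m f : `|\int[m]_x f x| <= sup_norm f * fine (m setT).
Proof.
have fM x : - sup_norm f <= f x <= sup_norm f by rewrite -ler_norml sup_norm_ge.
rewrite ler_norml -mulNr -!(int_cts_cst m); apply/andP; split; apply: le_int_cts.
  by move=> x; rewrite cst_cE; have /andP[] := fM x.
by move=> x; rewrite cst_cE; have /andP[] := fM x.
Qed.

Lemma pairing_bounded nu : exists2 c : R, 0 <= c &
  forall f, `|pairing f nu| <= c * sup_norm f.
Proof.
have [_ [m1 [m2 [_ _ _ nuE]]]] := hahn_M nu.
exists (fine (m1 setT) + fine (m2 setT)); first by rewrite addr_ge0// fine_ge0.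
move=> f; rewrite (pairing_diff nuE) (le_trans (ler_normB _ _))//.
by rewrite mulrDl lerD// mulrC int_cts_norm.
Qed.

Lemma closureCP (W : set (C R X)) f :
  closure W f <-> forall e : R, 0 < e -> exists2 w, W w & sup_norm (f - w) < e.
Proof.
split=> [Wf e e0|h B /nbhs_ballP[e /= e0 eB]].
  have [w [Ww fw]] := Wf _ (nbhsx_ballx f _ e0).
  by exists w => //; move: fw; rewrite -ball_normE.
have [w Ww fw] := h e e0; exists w; split => //; apply: eB.
by rewrite -ball_normE.
Qed.

Lemma pairing_closure (W : set (C R X)) nu :
  (forall w, W w -> pairing w nu = 0) ->
  forall w, closure W w -> pairing w nu = 0.
Proof.
move=> Wnu w /closureCP Ww; have [c c0 cP] := pairing_bounded nu.
apply/eqP; rewrite -normr_le0; apply/ler_addgt0Pl => e e0; rewrite addr0.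
have d0 : 0 < e / (c + 1) by rewrite divr_gt0// ltr_wpDl.
have [v Wv wv] := Ww _ d0.
rewrite -[w](subrK v) pairingDl (Wnu v)// addr0.
apply: le_trans (cP _) _; apply: (@le_trans _ _ (c * (e / (c + 1)))).
  by rewrite ler_wpM2l// ltW.
by rewrite mulrCA ler_piMr ?(ltW e0)// ler_pdivrMr ?mul1r ?lerDl// ltr_wpDl.
Qed.

Section probability.
Variable nu : M R X.
Hypothesis nu_prob : is_probability nu.

Lemma pairing_le f g : (forall x, f x <= g x) -> pairing f nu <= pairing g nu.
Proof.
have [nu0 _] := nu_prob; have [m num] := nonneg_M_measure nu0.
by move=> fg; rewrite !(pairing_nonneg num); exact: le_int_cts.
Qed.

Lemma pairing_cst (r : R) : pairing (cst_c r) nu = r.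
Proof.
have [nu0 nu1] := nu_prob; have [m num] := nonneg_M_measure nu0.
by rewrite (pairing_nonneg num) int_cts_cst -num// nu1 mulr1.
Qed.

End probability.

Section invariance.
Context {S : semigroupType}.
Variable a : cts_action S X.
Implicit Type s : S.

Lemma koopmanE s f x : koopman R a s f x = f (a s x).
Proof. by []. Qed.

Lemma action_measurable s :
  measurable_fun [set: borel X] (a s : borel X -> borel X).
Proof.
apply: (@measurability _ _ (borel X) (borel X) setT (a s) (@open X)) => // _ [U oU <-].
rewrite setTI; apply: borel_open.
by apply: open_comp => // x _; exact: cts_fun.
Qed.

Lemma action_preimage s (A : set (borel X)) : measurable A ->
  measurable (a s @^-1` A : set (borel X)).
Proof. by move=> mA; rewrite -[X in measurable X]setTI; exact: action_measurable. Qed.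

Lemma image_measure s m : exists m',
  (forall A, measurable A -> m' A = m (a s @^-1` A)) /\
  (forall f, \int[m']_x f x = \int[m]_x koopman R a s f x).
Proof.
have fin : fin_num_fun (measure_function_pushforward__canonical__measure_function_Measure
    m (action_measurable s)).
  by move=> A mA; apply: fin_num_measure; exact: action_preimage.
exists (finite_measure_of fin); split => // f.
congr fine; apply: (@integral_pushforward _ _ _ _ _ _ (action_measurable s) m setT
  (EFin \o f) _ _ measurableT).
  exact: measurable_int (integrable_cts m f).
exact: (integrable_cts m (koopman R a s f)).
Qed.

Lemma pairing_dual_koopman s f nu :
  pairing f (dual_koopman R a s nu) = pairing (koopman R a s f) nu.
Proof.
have [_ [m1 [m2 [_ _ _ nuE]]]] := hahn_M nu.
have [m1' [m1E int1]] := image_measure s m1.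
have [m2' [m2E int2]] := image_measure s m2.
rewrite (pairing_diff nuE) (@pairing_diff _ _ _ m1' m2') ?int1 ?int2// => A mA.
by rewrite dual_koopmanE// nuE ?m1E ?m2E//; exact: action_preimage.
Qed.

Lemma invariantP nu : Fix (dual_koopman R a) nu <->
  forall s f, pairing (koopman R a s f) nu = pairing f nu.
Proof.
split=> [nuS s f|nuS s]; first by rewrite -pairing_dual_koopman nuS.
by apply: pairing_inj => f; rewrite pairing_dual_koopman.
Qed.

(** Invariance of [nu] on subsets of a positive set [P] shows that the image of
    the positive part under [a s] dominates the positive part; as both have the
    same finite mass, they are equal. *)
Lemma invariant_jordan nu : Fix (dual_koopman R a) nu ->
  exists m1 m2, [/\ forall A, measurable A -> nu A = (m1 A - m2 A)%E,
    forall s (A : set (borel X)), measurable A -> m1 (a s @^-1` A) = m1 A &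
    forall s (A : set (borel X)), measurable A -> m2 (a s @^-1` A) = m2 A].
Proof.
move=> nuS.
have [P [m1 [m2 [mP m1E m2E nuE]]]] := hahn_M nu.
have E m A : measurable A -> m A = (fine (m A))%:E.
  by move=> mA; rewrite fineK// fin_num_measure.
have nuSA s (A : set (borel X)) : measurable A -> nu (a s @^-1` A) = nu A.
  by move=> mA; rewrite -(dual_koopmanE a s nu)// nuS.
have le1 s (A : set (borel X)) : measurable A -> (m1 A <= m1 (a s @^-1` A))%E.
  move=> mA; have mAP := measurableI _ _ mA mP.
  have m2AP : m2 (A `&` P) = 0%E.
    by rewrite m2E// -setIA setICr setI0 charge0 oppe0.
  have : (m1 (A `&` P) <= m1 (a s @^-1` (A `&` P)))%E.
    have := nuSA s _ mAP.
    rewrite (nuE _ mAP) (nuE _ (action_preimage s mAP)) m2AP sube0 => <-.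
    by rewrite leeBlDr ?fin_num_measure ?leeDl//; exact: action_preimage.
  rewrite m1E// -setIA setIid -m1E// => /le_trans; apply.
  by apply: le_measure; rewrite ?inE; try exact: action_preimage; move=> x [].
have eq1 s (A : set (borel X)) : measurable A -> m1 (a s @^-1` A) = m1 A.
  move=> mA; have mA' := action_preimage s mA.
  have mAC := measurableC mA; have mAC' := action_preimage s mAC.
  have T (B : set (borel X)) : measurable B -> (m1 B + m1 (~` B) = m1 setT)%E.
    move=> mB; rewrite -measureU//; [|exact: measurableC|exact: setICr].
    by rewrite setUCr.
  have := T _ mA; rewrite -(T _ mA') preimage_setC.
  have := le1 s _ mA; have := le1 s _ mAC.
  rewrite (E m1 _ mA) (E m1 _ mA') (E m1 _ mAC) (E m1 _ mAC').
  by rewrite !lee_fin => h1 h2 [h3]; congr EFin; lra.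
exists m1, m2; split => // s A mA.
have mA' := action_preimage s mA; have := nuSA s A mA.
rewrite (nuE _ mA) (nuE _ mA') eq1//.
rewrite (E m1 _ mA) (E m2 _ mA) (E m2 _ mA') => -[h]; congr EFin; lra.
Qed.

End invariance.

End duality.

(** * Linear subspaces and the weak-star topology *)

Section linear_subspaces.
Context {R : realType} {V : lmodType R}.
Implicit Types (G W : set V).

Definition linear_subspace W : Prop :=
  W 0 /\ forall (r : R) u v, W u -> W v -> W (r *: u + v).

Lemma subspaceZ W (r : R) u : linear_subspace W -> W u -> W (r *: u).
Proof. by move=> [W0 WZ] Wu; rewrite -[_ *: _]addr0; exact: WZ. Qed.

Lemma subspaceD W u v : linear_subspace W -> W u -> W v -> W (u + v).
Proof. by move=> [_ WZ] Wu Wv; rewrite -[u]scale1r; exact: WZ. Qed.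

Lemma subspaceN W u : linear_subspace W -> W u -> W (- u).
Proof. by move=> Ws Wu; rewrite -scaleN1r; exact: subspaceZ. Qed.

Lemma subspaceB W u v : linear_subspace W -> W u -> W v -> W (u - v).
Proof. by move=> Ws Wu Wv; apply: subspaceD => //; exact: subspaceN. Qed.

Lemma linear_span_subspace G : linear_subspace (linear_span G).
Proof.
split.
  exists 0%N, (fun=> 0), (fun=> 0); split; first by case.
  by rewrite big_ord0.
move=> r u v [n [b [w [Gw ->]]]] [m [c [z [Gz ->]]]].
exists (n + m)%N, (fun i : 'I_(n + m) => match fintype.split i with inl j => r * b j | inr j => c j end),
  (fun i : 'I_(n + m) => match fintype.split i with inl j => w j | inr j => z j end).
split; first by move=> i; case: fintype.split.
rewrite big_split_ord/=; congr (_ + _).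
  rewrite scaler_sumr; apply: eq_bigr => i _.
  by rewrite (unsplitK (inl i)) scalerA.
by apply: eq_bigr => i _; rewrite (unsplitK (inr i)).
Qed.

Lemma sub_linear_span G : G `<=` linear_span G.
Proof.
move=> v Gv; exists 1%N, (fun=> 1), (fun=> v); split => //.
by rewrite big_ord1 scale1r.
Qed.

Lemma linear_span_min G W : linear_subspace W -> G `<=` W -> linear_span G `<=` W.
Proof.
move=> Ws GW _ [n [b [w [Gw ->]]]].
elim/big_rec : _ => [|i x _ Wx]; first exact: Ws.1.
by apply: Ws.2 => //; exact: GW.
Qed.

Lemma Fix_subspace S (T : S -> V -> V) :
  (forall s (r : R) u v, T s (r *: u + v) = r *: T s u + T s v) ->
  linear_subspace (Fix T).
Proof.
move=> Tlin; split => [s|r u v Tu Tv s]; last by rewrite Tlin Tu Tv.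
have := Tlin s (-1) 0 0; rewrite scaler0 addr0 => ->.
by rewrite scaleN1r addNr.
Qed.

End linear_subspaces.

Section weak_star.
Context {R : realType} {X : compactMetricType R}.
Implicit Types (f g : C R X) (mu nu : M R X).

Let ev (nu : M R X) : {ptws C R X -> R} := pairing^~ nu.

Lemma weak_cvgP (F : set_system (M R X)) nu : Filter F ->
  F --> nu <-> forall f, pairing f @ F --> pairing f nu.
Proof.
move=> FF; split=> [Fnu f|Fnu].
  have h : ev @ F --> ev nu by exact: (cvg_comp _ _ Fnu (@initial_continuous _ _ ev nu)).
  exact: ((pointwise_cvgP (ev nu) (fmap_filter ev FF)).1 h f).
have h : ev @ F --> ev nu by apply/pointwise_cvgP => f; exact: Fnu.
move=> U [_ /= [[W oW <-]]] /= Wnu /filterS; apply; apply: h.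
exact: open_nbhs_nbhs.
Qed.

Lemma pairing_weak_continuous f : continuous (pairing f : M R X -> R).
Proof. by move=> nu; exact: ((weak_cvgP nu (nbhs_filter nu)).1 (fun U h => h) f). Qed.

Lemma weak_continuousP (T : topologicalType) (Psi : T -> M R X) :
  (forall f, continuous (fun x => pairing f (Psi x))) <-> continuous Psi.
Proof.
split=> [h x|h f x].
  by apply/weak_cvgP => f; exact: h.
exact: (cvg_comp _ _ (h x) (@pairing_weak_continuous f (Psi x))).
Qed.

(** Conditions are met one at a time: if [g] does not vanish on [W], some [w0] in
    [W] with value 1 at [g] adjusts that condition, and the others are solved in
    the kernel of [g]. *)
Lemma annihilator_solve (l : seq (C R X)) (W : set (M R X)) nu :
  linear_subspace W ->
  (forall f, (forall w, W w -> pairing f w = 0) -> pairing f nu = 0) ->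
  exists2 w, W w & forall f, f \in l -> pairing f w = pairing f nu.
Proof.
elim: l W nu => [|g l IHl] W nu Ws h; first by exists 0; [exact: Ws.1|].
have [Wg|] := pselect (forall w, W w -> pairing g w = 0).
  have [w Ww wl] := IHl W nu Ws h; exists w => // f; rewrite inE => /predU1P[->|/wl//].
  by rewrite Wg// h.
move=> /existsNP[w1 /not_implyP[Ww1 /eqP gw1]].
pose w0 := (pairing g w1)^-1 *: w1.
have Ww0 : W w0 by exact: subspaceZ.
have gw0 : pairing g w0 = 1 by rewrite pairingZr mulVf.
pose W' := [set w | W w /\ pairing g w = 0].
have W's : linear_subspace W'.
  split; first by split; [exact: Ws.1|exact: pairing0r].
  move=> r u v [Wu gu] [Wv gv]; split; first exact: Ws.2.
  by rewrite pairingDr pairingZr gu gv mulr0 addr0.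
have [f W'f|w [Ww gw] wl] := IHl W' (nu - pairing g nu *: w0) W's.
  have : pairing (f - pairing f w0 *: g) nu = 0.
    apply: h => w Ww.
    have := W'f (w - pairing g w *: w0); rewrite pairingBl pairingZl pairingBr pairingZr.
    rewrite mulrC => -> //; split; first by apply: subspaceB => //; exact: subspaceZ.
    by rewrite pairingBr pairingZr gw0 mulr1 subrr.
  by rewrite pairingBl pairingZl pairingBr pairingZr [_ * pairing f w0]mulrC.
exists (w + pairing g nu *: w0).
  by apply: subspaceD => //; exact: subspaceZ.
move=> f; rewrite inE pairingDr pairingZr => /predU1P[->|/wl ->].
  by rewrite gw gw0 mulr1 add0r.
by rewrite pairingBr pairingZr subrK.
Qed.

(** The bipolar theorem for subspaces: a weak-star neighbourhood only sees
    finitely many functions, and their values at [nu] are attained in [W]. *)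
Lemma weak_closureP (W : set (M R X)) nu : linear_subspace W ->
  closure W nu <->
  forall f, (forall w, W w -> pairing f w = 0) -> pairing f nu = 0.
Proof.
move=> Ws; split=> [Wnu f Wf|h].
  apply/eqP; rewrite -normr_le0; apply/ler_addgt0Pl => e e0; rewrite addr0.
  have [w [Ww /= fw]] : W `&` [set w | `|pairing f nu - pairing f w| <= e] !=set0.
    apply: Wnu.
    by have /cvgrPdist_le/(_ e e0) := @pairing_weak_continuous f nu.
  by move: fw; rewrite (Wf w Ww) subr0.
(* the filter base of exact solutions converges to [nu] *)
pose B (l : seq (C R X)) := [set w | W w /\ forall f, f \in l -> pairing f w = pairing f nu].
have FB : ProperFilter (filter_from [set: seq (C R X)] B).
  apply: filter_from_proper.
    apply: filter_from_filter; first by exists [::].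
    move=> l l' _ _; exists (l ++ l') => // w [Ww wl]; split; split=> // f fl.
      by apply: wl; rewrite mem_cat fl.
    by apply: wl; rewrite mem_cat fl orbT.
  by move=> l _; have [w Ww wl] := annihilator_solve l Ws h; exists w.
rewrite closureEcvg; exists (filter_from [set: seq (C R X)] B) => //; split.
  apply/weak_cvgP => f U /nbhs_singleton Uf.
  by exists [:: f] => // w [_ wf]; rewrite /= wf// inE.
by move=> U WU; exists [::] => // w [Ww _]; exact: WU.
Qed.

End weak_star.

(** * Separation by measures *)

Section separation.
Context {R : realType}.

(** Hahn-Banach for the sublinear functional [v |-> inf_(w in W) N (v - w)],
    which is nonpositive on [W] and at least [c] at [v0]; positivity of [N] on
    [W] keeps it finite. *)
Theorem sublinear_separation (V : lmodType R) (N : V -> R) (W : set V) v0 (c : R) :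
  sublinear N -> linear_subspace W -> (forall w, W w -> 0 <= N w) ->
  (forall w, W w -> c <= N (v0 - w)) ->
  exists l : {scalar V}, [/\ forall v, l v <= N v, forall w, W w -> l w = 0 & c <= l v0].
Proof.
move=> sN Ws W0 Wc.
pose E v := [set N (v - w) | w in W].
have Einf v : has_inf (E v).
  split; first by exists (N (v - 0)); exists 0 => //; exact: Ws.1.
  exists (- N (- v)) => _ [w Ww <-]; rewrite lerNl -subr_ge0 opprK addrC.
  apply: le_trans (sN.1 _ _); rewrite addrAC subrr sub0r.
  by apply: W0; exact: subspaceN.
have Ele v w : W w -> inf (E v) <= N (v - w).
  by move=> Ww; apply: ge_inf; [exact: (Einf v).2|exists w].
have leE (x : R) v : (forall w, W w -> x <= N (v - w)) -> x <= inf (E v).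
  by move=> h; apply: lb_le_inf => [|_ [w Ww <-]]; [exact: (Einf v).1|exact: h].
have pos_hom (t : R) v : 0 < t -> t * inf (E v) <= inf (E (t *: v)).
  move=> t0; apply: (leE _ _) => w Ww.
  have -> : t *: v - w = t *: (v - t^-1 *: w).
    by rewrite scalerBr scalerA divff ?gt_eqF// scale1r.
  rewrite sN.2 ?(ltW t0)// ler_pM2l//.
  by apply: Ele; exact: subspaceZ.
have sp : sublinear (fun v => inf (E v)).
  split=> [u v|t v].
    rewrite -lerBlDr; apply: (leE _ _) => w Ww; rewrite lerBlDr -lerBlDl.
    apply: (leE _ _) => z Wz; rewrite lerBlDl.
    apply: le_trans (Ele _ (w + z) _) _; first exact: subspaceD.
    by rewrite opprD addrACA; exact: sN.1.
  rewrite le_eqVlt => /predU1P[<-|t0].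
    rewrite scale0r mul0r; apply/eqP; rewrite eq_le; apply/andP; split.
      by apply: le_trans (Ele 0 0 Ws.1) _; rewrite subrr (sublinear0 sN).
    by apply: (leE _ _) => w Ww; rewrite sub0r; apply: W0; exact: subspaceN.
  apply/eqP; rewrite eq_le pos_hom// andbT.
  have := pos_hom t^-1 (t *: v); rewrite invr_gt0 => /(_ t0).
  by rewrite scalerA mulVf ?gt_eqF// scale1r mulrC ler_pdivrMr// mulrC.
have [l [lp lv0]] := hahn_banach v0 sp.
have lle v : l v <= N v.
  by apply: le_trans (lp v) _; have := Ele v 0 Ws.1; rewrite subr0.
have lW w : W w -> l w <= 0.
  move=> Ww; apply: le_trans (lp w) _.
  by have := Ele w w Ww; rewrite subrr (sublinear0 sN).
exists l; split=> [//|w Ww|]; last by rewrite lv0; exact: (leE _ _ Wc).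
apply/eqP; rewrite eq_le lW//= -oppr_le0 -linearN.
by apply: lW; exact: subspaceN.
Qed.

End separation.

Section sup_on.
Context {R : realType} {X : compactMetricType R}.
Variable K : set X.
Hypothesis K0 : K !=set0.
Implicit Types f g : C R X.

Definition sup_on f : R := sup [set f x | x in K].

Let has_sup_on f : has_sup [set f x | x in K].
Proof.
split; first by have [x Kx] := K0; exists (f x); exists x.
exists (sup_norm f) => _ [x _ <-]; apply: le_trans (sup_norm_ge f x).
exact: ler_norm.
Qed.

Lemma sup_on_ge f x : K x -> f x <= sup_on f.
Proof. by move=> Kx; apply: sup_upper_bound; [exact: has_sup_on|exists x]. Qed.

Lemma sup_on_le f (r : R) : (forall x, K x -> f x <= r) -> sup_on f <= r.
Proof.
move=> fr; apply: ge_sup; first exact: (has_sup_on f).1.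
by move=> _ [x Kx <-]; exact: fr.
Qed.

Lemma sublinear_sup_on : sublinear sup_on.
Proof.
have hom (t : R) f : 0 < t -> sup_on (t *: f) <= t * sup_on f.
  move=> t0; apply: sup_on_le => x Kx; rewrite cEZ ler_pM2l//.
  exact: sup_on_ge.
split=> [f g|t f].
  by apply: sup_on_le => x Kx; rewrite cED lerD// sup_on_ge.
rewrite le_eqVlt => /predU1P[<-|t0].
  rewrite scale0r mul0r; apply/eqP; rewrite eq_le; apply/andP; split.
    by apply: sup_on_le => x _; rewrite cE0.
  by have [x Kx] := K0; have := sup_on_ge 0 Kx; rewrite cE0.
apply/eqP; rewrite eq_le hom//=.
have := hom t^-1 (t *: f); rewrite invr_gt0 => /(_ t0).
by rewrite scalerA mulVf ?gt_eqF// scale1r mulrC ler_pdivlMr// mulrC.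
Qed.

End sup_on.

Section measure_separation.
Context {R : realType} {X : compactMetricType R}.
Implicit Types (f g : C R X) (W : set (C R X)).

(** A linear functional below the supremum over [K] is positive and normalised,
    so it is a probability measure, and it ignores functions vanishing on [K]. *)
Theorem positive_separation (K : set X) W g (c : R) :
  K !=set0 -> closed K -> linear_subspace W ->
  (forall w, W w -> 0 <= sup_on K w) ->
  (forall w, W w -> c <= sup_on K (g - w)) ->
  exists nu : M R X, [/\ is_probability nu, measure_support nu `<=` K,
    forall w, W w -> pairing w nu = 0 & c <= pairing g nu].
Proof.
move=> K0 cK Ws W0 Wc.
have [l [lK lW lg]] := sublinear_separation (sublinear_sup_on K0) Ws W0 Wc.
have l_le f (r : R) : (forall x, K x -> f x <= r) -> l f <= r.
  by move=> fr; apply: le_trans (lK f) _; exact: sup_on_le.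
have l_ge0 f : (forall x, 0 <= f x) -> 0 <= l f.
  move=> f0; rewrite -oppr_le0 -linearN; apply: (l_le _ _) => x _.
  by rewrite cEN oppr_le0.
have l1 : l (cst_c 1) = 1.
  apply/eqP; rewrite eq_le; apply/andP; split.
    by apply: (l_le _ _) => x _; rewrite cst_cE.
  by rewrite -lerN2 -linearN; apply: (l_le _ _) => x _; rewrite cEN cst_cE.
have [m mE] := riesz_representation l_ge0.
have mT : m setT = 1%E.
  rewrite -[LHS]fineK ?fin_num_measure// -[in RHS]l1 -mE int_cts_cst mul1r//.
exists (measure_M m); split.
- by split=> [A mA|]; rewrite measure_ME.
- move=> x nux; apply: contrapT => Kx.
  have [u [u0 Uu]] := open_cozero (closed_openC cK).
  have ux : 0 < u x by have : (~` K) x by []; rewrite Uu.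
  pose V := [set y | u x / 2 < u y].
  have oV : open V by exact: (open_comp (fun y _ => cts_fun _) (@open_gt R (u x / 2))).
  have Vx : V x by rewrite /V/= ltr_pdivrMr// mulr_natr mulr2n ltrDl.
  have mV := borel_open oV.
  have := nux V oV Vx; rewrite measure_ME//.
  rewrite -[m V]fineK ?fin_num_measure// lte_fin; apply/negP; rewrite -leNgt.
  rewrite -(pmulr_rle0 _ (divr_gt0 ux (ltr0Sn _ 1))).
  apply: le_trans (@mu_le_int_cts _ _ m u V (u x / 2) mV _) _.
    move=> y; rewrite indicE; have [yV|yV] := boolP (y \in V); last by rewrite mulr0.
    by rewrite mulr1; move: yV; rewrite inE => /ltW.
  rewrite mE; apply: (l_le _ _) => y Ky; rewrite leNgt; apply/negP => uy.
  by have : (~` K) y by rewrite Uu.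
- by move=> w Ww; rewrite pairing_measure mE lW.
- by rewrite pairing_measure mE.
Qed.

(** The signed measure is obtained as a difference of two positive ones: apply
    separation in [C(X)^2], with the maximum of the two suprema, to the pair
    [(g, - g)] and the subspace of the pairs [(w, - w)]. The resulting functional
    is positive in each component. *)
Theorem closure_separation W g : linear_subspace W -> ~ closure W g ->
  exists nu : M R X, (forall w, W w -> pairing w nu = 0) /\ pairing g nu != 0.
Proof.
move=> Ws nWg.
have [e e0 We] : exists2 e : R, 0 < e & forall w, W w -> e <= sup_norm (g - w).
  apply: contrapT => h; apply: nWg; apply/closureCP => e e0.
  apply: contrapT => h'; apply: h; exists e => // w Ww.
  by rewrite leNgt; apply/negP => we; apply: h'; exists w.
have T0 : [set: X] !=set0 by exists point.
pose s := sup_on [set: X].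
have ss : sublinear s := sublinear_sup_on T0.
pose N (v : C R X * C R X) := Num.max (s v.1) (s v.2).
have sN : sublinear N.
  split=> [u v|t v t0].
    rewrite /N ge_max; apply/andP; split; apply: le_trans (ss.1 _ _) _;
      by rewrite lerD// le_max lexx ?orbT.
  by rewrite /N !ss.2// maxr_pMr.
pose D : set (C R X * C R X) := [set v | W v.1 /\ v.2 = - v.1].
have Ds : linear_subspace D.
  split; first by split; [exact: Ws.1|rewrite /= oppr0].
  move=> r [u u'] [v v'] [/= Wu ->] [/= Wv ->]; split => /=; first exact: Ws.2.
  by rewrite scalerN opprD.
have norm_le f : sup_norm f <= Num.max (s f) (s (- f)).
  apply: sup_norm_le => x; rewrite ler_norml lerNl !le_max.
  by rewrite -cEN !sup_on_ge ?orbT.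
have [|w [/= Ww w2]|l [lN lD lg]] :=
    @sublinear_separation R (C R X * C R X)%type N D (g, - g) e sN Ds.
- move=> [w w'] [/= Ww ->]; apply: le_trans (norm_le w).
  exact: le_trans (normr_ge0 _) (sup_norm_ge w point).
- rewrite /N/= w2 -opprD; apply: le_trans (We _ Ww) (norm_le _).
have lin1 : scalar (fun f => l (f, 0)).
  move=> r u v; rewrite -linearP; congr (l _).
  by congr pair => /=; rewrite scaler0 addr0.
have lin2 : scalar (fun f => l (0, f)).
  move=> r u v; rewrite -linearP; congr (l _).
  by congr pair => /=; rewrite scaler0 addr0.
pose l1 : {scalar C R X} := HB.pack (fun f => l (f, 0)) (GRing.isLinear.Build R _ R *%R _ lin1).
pose l2 : {scalar C R X} := HB.pack (fun f => l (0, f)) (GRing.isLinear.Build R _ R *%R _ lin2).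
have s0 : s 0 = 0 by exact: sublinear0 ss.
have sN0 f : (forall x, 0 <= f x) -> s (- f) <= 0.
  by move=> f0; apply: sup_on_le => // x _; rewrite cEN oppr_le0.
have l1_ge0 f : (forall x, 0 <= f x) -> 0 <= l1 f.
  move=> f0; rewrite -oppr_le0 -linearN; apply: le_trans (lN _) _.
  by rewrite /N/= s0 ge_max lexx sN0.
have l2_ge0 f : (forall x, 0 <= f x) -> 0 <= l2 f.
  move=> f0; rewrite -oppr_le0 -linearN; apply: le_trans (lN _) _.
  by rewrite /N/= s0 ge_max lexx sN0.
have [m1 m1E] := riesz_representation l1_ge0.
have [m2 m2E] := riesz_representation l2_ge0.
have nuE f : pairing f (measure_M m1 - measure_M m2) = l (f, - f).
  rewrite pairingBr !pairing_measure m1E m2E -linearN/=.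
  rewrite -linearD; congr (l _).
  by congr pair => /=; rewrite ?addr0 ?add0r.
exists (measure_M m1 - measure_M m2); split=> [w Ww|]; rewrite nuE.
  by rewrite lD.
by rewrite gt_eqF// (lt_le_trans e0).
Qed.

End measure_separation.

(** * Separability, and integrals over the support *)

Section separability.
Context {R : realType} {X : compactMetricType R}.
Implicit Types f g : C R X.

Lemma mdist_cts (y : X) : continuous (fun x : X => mdist x y).
Proof.
by apply: lipschitz1_continuous => x z; rewrite lerBlDr; exact: metric_triangle.
Qed.

Definition dist_c (y : X) : C R X := mkcts (@mdist_cts y).

Lemma dist_cE y x : dist_c y x = mdist x y. Proof. by []. Qed.

Lemma finite_net (r : R) : 0 < r -> exists l : seq X,
  forall x, exists2 y, y \in l & mdist x y < r.
Proof.
move=> r0.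
have oB (y : X) : [set: X] y -> open [set x | mdist x y < r].
  by move=> _; exact: (open_comp (fun x _ => @mdist_cts y x) (@open_lt R r)).
have := @compact_setT R X; rewrite compact_cover => /(_ _ setT _ oB)[|D _ Dcov].
  by move=> x _; exists x => //=; rewrite mdistxx.
exists (finmap.enum_fset D) => x; have [y Dy xy] := Dcov x I.
by exists y.
Qed.

(** Heine's theorem, by compactness. *)
Lemma uniform_continuity f (e : R) : 0 < e ->
  exists2 d : R, 0 < d & forall x y, mdist x y < d -> `|f x - f y| <= e.
Proof.
move=> e0.
have [N _ /(_ N (leqnn N)) fN] : \forall n \near \oo, [set: X] `<=`
    (fun x => forall y, mdist x y < n.+1%:R^-1 -> `|f x - f y| <= e).
  apply: ((compact_near_coveringP [set: X]).1 compact_setT nat \oo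
    (fun n x => forall y, mdist x y < n.+1%:R^-1 -> `|f x - f y| <= e) _) => x _.
  have e2 : 0 < e / 2 by rewrite divr_gt0.
  have /cvgrPdist_le/(_ _ e2)/nbhs_ballP[r /= r0 xr] := @cts_fun _ _ f x.
  have r2 : 0 < r / 2 by rewrite divr_gt0.
  exists (ball x (r / 2), [set n | n.+1%:R^-1 < r / 2]) => /=.
    split; first exact: nbhsx_ballx.
    exact: (near_infty_natSinv_lt (PosNum r2)).
  move=> [y n] /= [xy nr] z yz.
  have fxy : `|f x - f y| <= e / 2.
    by apply: xr; apply: le_ball xy; lra.
  have fxz : `|f x - f z| <= e / 2.
    apply: xr; rewrite ballEmdist/=; move: xy; rewrite ballEmdist/= => xy.
    by rewrite (le_lt_trans (metric_triangle x y z))// [r]splitr ltrD// (lt_trans yz).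
  rewrite [e]splitr -[X in `|X|](subrKA (f x)) (le_trans (ler_normD _ _))//.
  by rewrite lerD// distrC.
by exists N.+1%:R^-1 => // x y xy; exact: (fN x I).
Qed.

Let tent (k : nat) (q : rat) (y : X) : C R X := cst_c (ratr q) + k%:R *: dist_c y.

Let tents (l : seq X) (k : nat) (q0 : rat) (q : seq rat) : C R X :=
  foldr (fun p => min_c (tent k p.1 p.2)) (cst_c (ratr q0)) (zip q l).

Let tentsP l k q0 (q : X -> rat) x (r : R) :
  (r <= tents l k q0 (map q l) x) =
  (r <= ratr q0) && all (fun y => r <= ratr (q y) + k%:R * mdist x y) l.
Proof.
rewrite /tents; elim: l => [|y l IHl] /=; first by rewrite cst_cE andbT.
rewrite min_cE le_min IHl andbCA; congr andb.
by rewrite cED cst_cE cEZ dist_cE.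
Qed.

Let tents_ub l k q0 (q : X -> rat) x y : y \in l ->
  tents l k q0 (map q l) x <= ratr (q y) + k%:R * mdist x y.
Proof.
have := lexx (tents l k q0 (map q l) x).
by rewrite tentsP => /andP[_ /allP]; exact.
Qed.

(** The functions [min_i (q_i + k d(., x_i))], with rational [q_i] and the [x_i]
    running through one of countably many finite nets, are dense. For [q_i]
    slightly above [f x_i], such a minimum stays close to [f] from below by
    uniform continuity near [x_i] and, once [k] is large, by the slope [k] far
    from it; it stays close from above because some [x_i] is close to [x]. *)
Theorem cts_separable : exists d : nat -> C R X,
  forall f (e : R), 0 < e -> exists n, sup_norm (f - d n) <= e.
Proof.
have /choice[net netP] (n : nat) : exists l : seq X,
    forall x, exists2 y, y \in l & mdist x y < n.+1%:R^-1.
  by apply: finite_net; rewrite invr_gt0.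
pose I := (nat * nat * rat * seq rat)%type.
pose d (i : I) : C R X := tents (net i.1.1.1) i.1.1.2 i.1.2 i.2.
exists (fun n => if unpickle n is Some i then d i else 0) => f e e0.
suff [i fi] : exists i, sup_norm (f - d i) <= e.
  by exists (pickle i); rewrite pickleK.
pose e3 := e / 3; have e30 : 0 < e3 by rewrite divr_gt0.
have [r r0 fr] := uniform_continuity f e30.
have fM x : - sup_norm f <= f x <= sup_norm f by rewrite -ler_norml sup_norm_ge.
pose k := (Num.truncn ((sup_norm f + sup_norm f) / r)).+1.
have kr : sup_norm f + sup_norm f <= k%:R * r.
  by rewrite -ler_pdivrMr//; apply/ltW/truncnS_gt.
(* a net so fine that the slope [k] costs at most [e3] at the nearest point *)
pose d0 := Num.min r (e3 / k%:R).
have d00 : 0 < d0 by rewrite lt_min r0 divr_gt0.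
have [n nd] : exists n, n.+1%:R^-1 < d0.
  have [n _ /(_ n (leqnn n)) nd] := near_infty_natSinv_lt (PosNum d00).
  by exists n.
have ratE (t : R) : exists q : rat, t <= ratr q <= t + e3.
  have tt : t < t + e3 by rewrite ltrDl.
  have [q] := rat_in_itvoo tt.
  by rewrite in_itv/= => /andP[/ltW tq /ltW qt]; exists q; rewrite tq.
have /choice[q qP] x : exists q : rat, f x <= ratr q <= f x + e3.
  exact: ratE.
have [q0 /andP[q0P _]] := ratE (sup_norm f).
exists (n, k, q0, map q (net n)); apply: sup_norm_le => x; rewrite cEB /d/=.
set t := tents _ _ _ _.
have lo : f x - e3 <= t x.
  rewrite tentsP; apply/andP; split.
    by have /andP[_ h] := fM x; lra.
  apply/allP => y _; have /andP[qy _] := qP y.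
  have [xy|xy] := ltP (mdist x y) r.
    have := fr x y xy; rewrite ler_norml => /andP[_ h].
    have : 0 <= k%:R * mdist x y by rewrite mulr_ge0// mdist_ge0.
    lra.
  have : k%:R * r <= k%:R * mdist x y by rewrite ler_wpM2l.
  have /andP[h1 h2] := fM x; have /andP[h3 h4] := fM y; lra.
have hi : t x <= f x + e3 + e3 + e3.
  have [y yn xy] := netP n x; apply: le_trans (tents_ub _ _ _ _ yn) _.
  have xyd := lt_trans xy nd.
  have xyr : mdist x y < r by move: xyd; rewrite lt_min => /andP[].
  have xyk : k%:R * mdist x y <= e3.
    rewrite mulrC -ler_pdivlMr//.
    by move: xyd; rewrite lt_min => /andP[_ /ltW].
  have /andP[_ qy] := qP y.
  have := fr x y xyr; rewrite ler_norml => /andP[h _].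
  lra.
have e3e : e3 + e3 + e3 = e by rewrite /e3; field.
by rewrite ler_norml; apply/andP; split; lra.
Qed.

End separability.

Section support.
Context {R : realType} {X : compactMetricType R}.
Implicit Types (f g : C R X) (nu : M R X).

(** The positive part [h] of [f - g] vanishes on [K]; its level set [{h >= e}] is
    compact and disjoint from the support, hence covered by finitely many null
    open sets. *)
Lemma pairing_le_on nu (K : set X) f g : is_probability nu ->
  measure_support nu `<=` K -> (forall x, K x -> f x <= g x) ->
  pairing f nu <= pairing g nu.
Proof.
move=> pnu nuK fg; have [nu0 nu1] := pnu; have [m mE] := nonneg_M_measure nu0.
pose h := (f - g) - min_c (f - g) 0.
have hE x : h x = (f x - g x) - Num.min (f x - g x) 0.
  by rewrite /h cEB min_cE !cEB cE0.
have h0 x : 0 <= h x by rewrite hE subr_ge0 ge_min lexx.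
have hK x : K x -> h x = 0.
  by move=> Kx; rewrite hE min_l ?subrr// subr_le0; exact: fg.
rewrite -subr_le0 -pairingBl; apply/ler_addgt0Pl => e e0; rewrite addr0.
apply: (@le_trans _ _ (pairing h nu)).
  apply: (pairing_le pnu) => x.
  by rewrite hE cEB lerBrDr gerDl ge_min lexx orbT.
pose F := [set x | e <= h x].
have cF : closed F by exact: (closed_comp (fun y _ => cts_fun _) (@closed_ge R e)).
have kF : compact F by exact: (subclosed_compact cF compact_setT).
have FU x : exists U : set X, [/\ open U, nu U = 0%E & F x -> U x].
  have [Fx|nFx] := pselect (F x); last first.
    by exists set0; rewrite charge0; split => //; exact: open0.
  apply: contrapT => nU.
  suff /nuK/hK hx : measure_support nu x by move: Fx; rewrite /F/= hx leNgt e0.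
  move=> U oU Ux; rewrite lt_neqAle nu0 ?andbT; last exact: borel_open.
  by apply/eqP => U0; apply: nU; exists U.
have /choice[U UP] := FU.
have oU x : F x -> open (U x) by have [] := UP x.
move: kF; rewrite compact_cover => /(_ _ F U oU)[|D _ FD].
  by move=> x Fx; exists x => //; have [_ _] := UP x; exact.
have mF : m F = 0%E.
  move: FD; set UD := cover _ _ => FD.
  have null : measurable (UD : set (borel X)) /\ m UD = 0%E.
    rewrite /UD coverE bigcup_fset.
    elim/big_ind : _ => [|A B [mA A0] [mB B0]|x _]; first by rewrite measure0.
      split; first exact: measurableU.
      apply/eqP; rewrite eq_le measure_ge0 andbT.
      by apply: le_trans (measureU2 m mA mB) _; rewrite [X in (X + _)%E]A0 [X in (_ + X)%E]B0 adde0.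
    by have [oUx Ux0 _] := UP x; have mUx := borel_open oUx; rewrite -mE.
  apply/eqP; rewrite eq_le measure_ge0 andbT -null.2.
  by apply: le_measure; rewrite ?inE//; [exact: borel_closed|exact: null.1].
have -> : e = pairing (cst_c e) nu by rewrite pairing_cst.
rewrite -subr_le0 -pairingBl (pairing_nonneg mE).
have -> : 0 = sup_norm h * fine (m F) by rewrite mF mulr0.
apply: int_cts_le_mu; first exact: borel_closed.
move=> x; rewrite cEB cst_cE indicE; have [_|xF] := boolP (x \in F).
  rewrite mulr1 lerBlDr (le_trans (ler_norm _))// (le_trans (sup_norm_ge h x))//.
  by rewrite lerDl ltW.
rewrite mulr0 subr_le0 leNgt; apply/negP => ehx.
by move: xF; rewrite notin_setE; apply; exact: ltW.
Qed.

End support.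

(** * Restriction of measures *)

Section restricted_measures.
Context {R : realType} {X : compactMetricType R}.
Implicit Types (m : {finite_measure set (borel X) -> \bar R}) (D : set (borel X)).

Lemma restricted_measure m D : measurable D ->
  exists m' : {finite_measure set (borel X) -> \bar R},
    forall A, m' A = m (A `&` D).
Proof.
move=> mD; have fin : fin_num_fun (mrestr m mD).
  by move=> A mA; rewrite /mrestr fin_num_measure//; exact: measurableI.
by exists (finite_measure_of fin).
Qed.

Lemma int_restricted_le m m' D (f : C R X) (c : R) : measurable D ->
  (forall A, m' A = m (A `&` D)) -> (forall x, D x -> f x <= c) ->
  \int[m']_x f x <= c * fine (m D).
Proof.
move=> mD m'E fc.
have mT : m D = m' setT by rewrite m'E setTI.
rewrite mT -int_cts_cst -subr_le0 -int_ctsB.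
have -> : 0 = sup_norm (f - cst_c c) * fine (m' (~` D)).
  by rewrite m'E setICl measure0 mulr0.
apply: int_cts_le_mu; first exact: measurableC.
move=> x; rewrite indicE; have [_|xD] := boolP (x \in ~` D).
  by rewrite mulr1 (le_trans (ler_norm _))// sup_norm_ge.
rewrite mulr0 cEB cst_cE subr_le0; apply: fc.
by move: xD; rewrite notin_setE => /contrapT.
Qed.

End restricted_measures.

(** * Annihilators of fixed spaces and coboundaries *)

Section pointwise_ergodic_actions.
Context {R : realType} {S : semigroupType} {X : compactMetricType R}.
Variable a : cts_action S X.
Implicit Types (f g u w : C R X) (mu nu : M R X) (s t : S) (x y : X).

Local Notation T := (koopman R a).
Local Notation T' := (dual_koopman R a).
Local Notation FixC := (Fix T).
Local Notation FixM := (Fix T').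
Local Notation CobC := (closure (Cob T)).
Local Notation CobM := (closure (Cob T')).
Local Notation Phi := (ergodic_map R a).
Local Notation K x := (closure (action_orbit a x)).

(** As [B] is contained in its preimage, which has the same finite mass, the two
    agree up to a null set. *)
Lemma forward_invariant_restriction (m : {finite_measure set (borel X) -> \bar R})
    (B : set (borel X)) :
  (forall s (A : set (borel X)), measurable A -> m (a s @^-1` A) = m A) ->
  measurable B -> (forall s x, B x -> B (a s x)) ->
  forall s (A : set (borel X)), measurable A ->
  m (a s @^-1` A `&` B) = m (A `&` B).
Proof.
move=> mS mB Bs s A mA.
have mA' := action_preimage a s mA; have mB' := action_preimage a s mB.
have mAB := measurableI _ _ mA mB.
have null : m (a s @^-1` B `\` B) = 0%E.
  transitivity (m (a s @^-1` B) - m (a s @^-1` B `&` B))%E.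
    by apply: measureD => //; rewrite -ge0_fin_numE// fin_num_measure.
  rewrite (mS s B mB) (setIidr _); last by move=> x Bx; exact: Bs.
  by rewrite subee// fin_num_measure.
have mN := measurableD mB' mB.
rewrite -[RHS](mS s _ mAB); apply/eqP; rewrite eq_le; apply/andP; split.
  apply: le_measure; rewrite ?inE; [exact: measurableI|exact: action_preimage|].
  by move=> x [Ax Bx]; split => //; exact: Bs.
apply: (@le_trans _ _ (m ((a s @^-1` A `&` B) `|` (a s @^-1` B `\` B)))).
  apply: le_measure; rewrite ?inE; [exact: action_preimage| |].
    by apply: measurableU => //; exact: measurableI.
  by move=> x [Ax Bx]; have [Bx'|Bx'] := pselect (B x); [left|right].
apply: le_trans (measureU2 m (measurableI _ _ mA' mB) mN) _.
by rewrite [X in (_ + X)%E]null adde0.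
Qed.

Lemma koopman_linear s (r : R) f g : T s (r *: f + g) = r *: T s f + T s g.
Proof. exact/continuousEP. Qed.

Lemma dual_koopman_linear s (r : R) mu nu : T' s (r *: mu + nu) = r *: T' s mu + T' s nu.
Proof.
apply: pairing_inj => f.
by rewrite pairing_dual_koopman !pairingDr !pairingZr !pairing_dual_koopman.
Qed.

Lemma FixC_subspace : linear_subspace FixC.
Proof. exact/Fix_subspace/koopman_linear. Qed.

Lemma FixM_subspace : linear_subspace FixM.
Proof. exact/Fix_subspace/dual_koopman_linear. Qed.

Lemma Cob_koopman_annihilator nu :
  (forall w, Cob T w -> pairing w nu = 0) <-> FixM nu.
Proof.
split=> [h|/invariantP nuS w].
  apply/invariantP => s f; apply/eqP; rewrite eq_sym -subr_eq0 -pairingBl; apply/eqP.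
  by apply: h; apply: sub_linear_span; exists f, s.
apply: (@linear_span_min _ _ _ [set w | pairing w nu = 0]).
  split=> [|r u v /= u0 v0]; first exact: pairing0l.
  by rewrite pairingDl pairingZl u0 v0 mulr0 addr0.
by move=> _ [f [s ->]] /=; rewrite pairingBl nuS subrr.
Qed.

Lemma Cob_dual_koopman_annihilator f :
  (forall nu, Cob T' nu -> pairing f nu = 0) <-> FixC f.
Proof.
split=> [h s|fS nu].
  apply/continuousEP => x.
  have := h (delta R x - T' s (delta R x)).
  rewrite pairingBr pairing_dual_koopman !pairing_delta => /(_ _)/eqP.
  rewrite subr_eq0 => /(_ _)/eqP -> //.
  by apply: sub_linear_span; exists (delta R x), s.
apply: (@linear_span_min _ _ _ [set nu | pairing f nu = 0]).
  split=> [|r u v /= u0 v0]; first exact: pairing0r.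
  by rewrite pairingDr pairingZr u0 v0 mulr0 addr0.
by move=> _ [mu [s ->]] /=; rewrite pairingBr pairing_dual_koopman fS subrr.
Qed.

(** The bipolar theorem in [C(X)]; it rests on the Riesz representation. *)
Lemma CobC_annihilator f : CobC f <-> forall nu, FixM nu -> pairing f nu = 0.
Proof.
split=> [Cf nu /Cob_koopman_annihilator nuC|h]; first exact: pairing_closure Cf.
apply: contrapT => /(closure_separation (linear_span_subspace _)).
by move=> [nu [/Cob_koopman_annihilator/h ->]]; rewrite eqxx.
Qed.

Lemma CobM_annihilator nu : CobM nu <-> forall f, FixC f -> pairing f nu = 0.
Proof.
rewrite weak_closureP; last exact: linear_span_subspace.
by split=> h f /Cob_dual_koopman_annihilator; exact: h.
Qed.

Lemma Fix_orbit_closure f x y : FixC f -> K x y -> f y = f x.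
Proof.
move=> fS; have cl : closed [set y | f y = f x].
  exact: (closed_comp (fun y _ => cts_fun _) (@closed_eq R (f x))).
rewrite -[f y = f x]/([set y | f y = f x] y) ((closure_id _).1 cl).
apply: closureS => _ [s ->] /=.
by have /continuousEP/(_ x) := fS s.
Qed.

(** A fixed function is constant on the orbit closure, so an invariant
    probability measure there evaluates it at [x], although [x] itself may lie
    outside the orbit closure. *)
Lemma pairing_Fix f x mu : FixC f -> invariant_probabilities a (K x) mu ->
  pairing f mu = f x.
Proof.
move=> fS [pmu _ suppmu]; rewrite -(pairing_cst pmu (f x)).
apply/eqP; rewrite eq_le; apply/andP; split; apply: (pairing_le_on pmu suppmu) => y Ky;
  by rewrite cst_cE (Fix_orbit_closure fS Ky).
Qed.

Lemma invariant_probabilities_orbit s x :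
  invariant_probabilities (R := R) a (K (a s x)) `<=` invariant_probabilities a (K x).
Proof.
move=> mu [pmu muS suppmu]; split => //; apply: subset_trans suppmu _.
by apply: closureS => _ [t ->]; exists (t * s)%g; rewrite actM.
Qed.

(** * Localisation to orbit closures *)

Section admitting.
Hypothesis adm : pointwise_invariant_measure_admitting R a.

Lemma ergodic_mapP x : invariant_probabilities a (K x) (Phi x).
Proof. exact: (xgetPex 0 (adm x)). Qed.

(** A probability measure has a nonempty support, so the orbit closures are
    nonempty. *)
Lemma orbit_nonempty x : action_orbit a x !=set0.
Proof.
apply/set0P/negP => /eqP orb0; have [mu [pmu _ suppmu]] := adm x.
suff : pairing (cst_c 1) mu <= pairing (cst_c 0) mu.
  by rewrite !(pairing_cst pmu) ler10.
by apply: (pairing_le_on pmu suppmu) => y; rewrite orb0 closure0.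
Qed.

(** Otherwise separation on the orbit closure would produce an invariant
    probability measure there with integral of [g] at least [e]. *)
Lemma orbit_coboundary_approx g x (e : R) : 0 < e ->
  (forall mu, invariant_probabilities a (K x) mu -> pairing g mu <= 0) ->
  exists2 w, Cob T w & forall y, K x y -> g y - w y <= e.
Proof.
move=> e0 gx; have [_ [s _]] := orbit_nonempty x.
have K0 : K x !=set0 by exists (a s x); apply: subset_closure; exists s.
have Ws : linear_subspace (Cob T) by exact: linear_span_subspace.
apply: contrapT => h.
have [w Ww|w Ww|nu [pnu nuK nuW gnu]] := @positive_separation R X (K x) (Cob T) g e
    K0 (@closed_closure _ _) Ws.
- have [mu [pmu muS suppmu]] := adm x.
  rewrite -((Cob_koopman_annihilator mu).2 muS w Ww) -(pairing_cst pmu (sup_on (K x) w)).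
  by apply: (pairing_le_on pmu suppmu) => y Ky; rewrite cst_cE sup_on_ge.
- rewrite leNgt; apply/negP => gw; apply: h; exists w => // y Ky.
  by rewrite -cEB (le_trans (sup_on_ge K0 _ Ky))// ltW.
have : pairing g nu <= 0.
  by apply: gx; split => //; exact/Cob_koopman_annihilator.
by rewrite leNgt (lt_le_trans e0).
Qed.

(** By separability, countably many coboundaries [w k] suffice to bound [g] by
    [w k + e] on every orbit. The set [A k] of the points on whose orbit [w k]
    works is closed and forward invariant, so the differences of finite unions
    of such sets carry invariant restrictions of [m]. On each piece [w k]
    integrates to 0, hence [g] to at most [e] times the mass; and the pieces
    exhaust [m]. *)
Theorem invariant_integral_le0 g (m : {finite_measure set (borel X) -> \bar R}) :
  (forall s (A : set (borel X)), measurable A -> m (a s @^-1` A) = m A) ->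
  (forall x mu, invariant_probabilities a (K x) mu -> pairing g mu <= 0) ->
  \int[m]_x g x <= 0.
Proof.
move=> mS gK.
have [_ [s0 _]] := orbit_nonempty point.
suff main (e : R) : 0 < e -> \int[m]_x g x <= e * fine (m setT).
  apply/ler_addgt0Pl => e e0; rewrite addr0.
  pose c := fine (m setT); have c0 : 0 <= c by rewrite fine_ge0.
  have d0 : 0 < e / (c + 1) by rewrite divr_gt0// ltr_wpDl.
  apply: le_trans (main _ d0) _; rewrite -/c mulrAC ler_pdivrMr ?ltr_wpDl//.
  by rewrite ler_pM2l// lerDl.
move=> e0; pose e3 := e / 3; have e30 : 0 < e3 by rewrite divr_gt0.
have e3e : e = e3 + (e3 + e3) by rewrite /e3; field.
have [d dP] := @cts_separable R X.
(* [w k] is a coboundary close to [d k] whenever there is one *)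
have /choice[w wP] k : exists w, Cob T w /\
    ((exists2 v, Cob T v & sup_norm (v - d k) <= e3) -> sup_norm (w - d k) <= e3).
  have [[v Cv vd]|nv] := pselect (exists2 v, Cob T v & sup_norm (v - d k) <= e3).
    by exists v.
  by exists 0; split=> [|/nv//]; exact: (linear_span_subspace _).1.
pose A k : set X := [set x | forall s, g (a s x) - w k (a s x) <= e].
have cA k : closed (A k).
  have -> : A k = \bigcap_(s in [set: S]) [set x | T s (g - w k) x <= e].
    by apply/seteqP; split=> x /= Ax s => [_|]; [exact: Ax|exact: (Ax s I)].
  apply: closed_bigI => s _.
  exact: (closed_comp (fun y _ => cts_fun _) (@closed_le R e)).
have As k s x : A k x -> A k (a s x) by move=> Ax t; rewrite -actM; exact: Ax.
have covA x : exists k, A k x.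
  have [v Cv vx] := orbit_coboundary_approx e30 (gK x).
  have [k vk] := dP v _ e30.
  have wk : sup_norm (w k - d k) <= e3 by apply: (wP k).2; exists v.
  exists k => s.
  have := vx (a s x) (subset_closure (ex_intro _ s erefl)).
  have := le_trans (sup_norm_ge (v - d k) (a s x)) vk.
  have := le_trans (sup_norm_ge (w k - d k) (a s x)) wk.
  rewrite !cEB !ler_norml => /andP[h1 _] /andP[_ h2] h3; lra.
pose B n : set X := \bigcup_(k < n) A k.
have cB n : closed (B n) by apply: closed_bigcup => //; exact: finite_II.
have mB n : measurable (B n : set (borel X)) by exact: borel_closed.
have Bs n s x : B n x -> B n (a s x) by move=> [k kn Ax]; exists k => //; exact: As.
have mBS n s (C : set (borel X)) : measurable C ->
    m (a s @^-1` C `&` B n) = m (C `&` B n).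
  by move=> mC; apply: forward_invariant_restriction => //; exact: Bs.
have fineE (C : set (borel X)) : measurable C -> m C = (fine (m C))%:E.
  by move=> mC; rewrite fineK// fin_num_measure.
have step n : forall m' : {finite_measure set (borel X) -> \bar R},
    (forall C, m' C = m (C `&` B n)) -> \int[m']_x g x <= e * fine (m (B n)).
  elim: n => [|n IHn] m' m'E.
    by apply: int_restricted_le => // x [].
  pose D : set (borel X) := A n `\` B n.
  have mD : measurable D by apply: measurableD => //; exact: borel_closed.
  have [mBn mBnE] := restricted_measure m (mB n).
  have [mDn mDnE] := restricted_measure m mD.
  have BD (C : set (borel X)) : measurable C ->
      (m (C `&` B n.+1) = m (C `&` B n) + m (C `&` D))%E.
    move=> mC; rewrite -measureU; try exact: measurableI; last first.
      by rewrite -subset0 => x [[_ Bx] [_ [_ /(_ Bx)]]].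
    rewrite -setIUr; congr (m (C `&` _)); apply/seteqP; split=> x.
      move=> [k /=]; rewrite ltnS leq_eqVlt => /predU1P[->|kn] Ax.
        by have [Bx|nBx] := pselect (B n x); [left|right].
      by left; exists k.
    by move=> [[k /= kn Ax]|[Ax _]]; [exists k => //=; exact: ltnW|exists n => /=].
  have -> : \int[m']_x g x = \int[mBn]_x g x + \int[mDn]_x g x.
    rewrite -int_cts_measure_add; apply: eq_int_cts_measure => C mC.
    by rewrite finite_measure_addE mBnE mDnE m'E BD.
  have -> : fine (m (B n.+1)) = fine (m (B n)) + fine (m D).
    have := BD setT measurableT; rewrite !setTI => ->.
    by rewrite fineD// fin_num_measure.
  rewrite mulrDr; apply: lerD; first exact: IHn.
  have mDS : FixM (measure_M mDn).
    move=> s; apply: M_ext => C mC; have mC' := action_preimage a s mC.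
    rewrite dual_koopmanE// !measure_ME// !mDnE.
    have := BD _ mC; have := BD _ mC'; rewrite !mBS//.
    move=> ->; rewrite (fineE _ (measurableI _ _ mC (mB n))).
    rewrite (fineE _ (measurableI _ _ mC mD)) (fineE _ (measurableI _ _ mC' mD)).
    by move=> -[h]; congr EFin; lra.
  have wD : pairing (w n) (measure_M mDn) = 0.
    by move/Cob_koopman_annihilator : mDS; apply; exact: (wP n).1.
  (* membership in [A n] bounds [g - w n] on the orbit of [x], not at [x] *)
  have -> : \int[mDn]_x g x = \int[mDn]_x T s0 (g - w n) x.
    rewrite -!pairing_measure (invariantP a _).1// pairingBl wD subr0//.
  apply: (int_restricted_le mD mDnE) => x [Ax _].
  by rewrite koopmanE cEB; exact: Ax.
have mCB n : measurable (~` B n : set (borel X)) by exact: measurableC.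
apply/ler_addgt0Pl => r r0.
have [n Bn] : exists n, sup_norm g * fine (m (~` B n)) <= r.
  have B0 : \bigcap_n ~` B n = set0.
    rewrite -subset0 => x Bx; have [k Akx] := covA x.
    by apply: (Bx k.+1 I); exists k => /=.
  have q0 : 0 < r / (sup_norm g + 1).
    by rewrite divr_gt0// ltr_wpDl// (le_trans _ (sup_norm_ge g point)).
  have := @nonincreasing_cvg_mu _ (borel X) R m (fun n => ~` B n).
  rewrite B0 measure0 => /(_ _ mCB measurable0 _).
  move=> /(_ _ _ [set y | (y < (r / (sup_norm g + 1))%:E)%E])[].
  - by rewrite -ge0_fin_numE// fin_num_measure.
  - move=> i j ij; apply/subsetPset; apply: subsetC => x [k /= ki Ax].
    by exists k => //=; exact: leq_trans ki ij.
  - by apply: open_ereal_lt'; rewrite lte_fin.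
  move=> n _ /(_ n (leqnn n)) /= /ltW; rewrite fineE// lee_fin => mn; exists n.
  have g0 : 0 <= sup_norm g by rewrite (le_trans _ (sup_norm_ge g point)).
  apply: le_trans (ler_wpM2l g0 mn) _.
  by rewrite mulrCA ler_piMr ?(ltW r0)// ler_pdivrMr ?mul1r ?lerDl// ltr_wpDl.
have [mBn mBnE] := restricted_measure m (mB n).
have [mCn mCnE] := restricted_measure m (mCB n).
have -> : \int[m]_x g x = \int[mCn]_x g x + \int[mBn]_x g x.
  rewrite -int_cts_measure_add; apply: eq_int_cts_measure => C mC.
  rewrite finite_measure_addE mBnE mCnE -measureU; try exact: measurableI.
    by rewrite -setIUr setUC setUCr setIT.
  by rewrite setIACA setICl setI0.
apply: lerD.
  apply: le_trans Bn; apply: (int_restricted_le _ mCnE) => // x _.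
  exact: le_trans (ler_norm _) (sup_norm_ge g x).
apply: le_trans (step n mBn mBnE) _; rewrite ler_pM2l// fine_le ?fin_num_measure//.
by apply: le_measure; rewrite ?inE.
Qed.

Lemma invariant_pairing0 g nu : FixM nu ->
  (forall x mu, invariant_probabilities a (K x) mu -> pairing g mu = 0) ->
  pairing g nu = 0.
Proof.
move=> nuS gK; have [m1 [m2 [nuE m1S m2S]]] := invariant_jordan nuS.
have int0 (m : {finite_measure set (borel X) -> \bar R}) :
    (forall s (A : set (borel X)), measurable A -> m (a s @^-1` A) = m A) ->
    \int[m]_x g x = 0.
  move=> mS; apply/eqP; rewrite eq_le; apply/andP; split.
    by apply: invariant_integral_le0 => // x mu /gK ->.
  rewrite -oppr_le0 -int_ctsN.
  apply: invariant_integral_le0 => // x mu /gK gmu.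
  by rewrite pairingNl gmu oppr0.
by rewrite (pairing_diff nuE) !int0// subrr.
Qed.

(** * The mean ergodic projections *)

Section projection.
Hypothesis dsC : direct_sum FixC CobC.
Local Notation P := (projection_along FixC CobC).

(** [f - P f] is a limit of coboundaries and integrates to 0, while the fixed
    function [P f] integrates to its value at [x]. *)
Lemma projection_pairing f x mu : invariant_probabilities a (K x) mu ->
  P f x = pairing f mu.
Proof.
move=> muK; have [PF PC] := projection_alongP dsC f.
have [_ muS _] := muK.
have /CobC_annihilator/(_ mu muS)/eqP := PC.
by rewrite pairingBl subr_eq0 => /eqP ->; rewrite (pairing_Fix PF muK).
Qed.

Lemma projection_ergodic_map f x : P f x = pairing f (Phi x).
Proof. exact/projection_pairing/ergodic_mapP. Qed.

Lemma projection_Fix f : FixC f -> P f = f.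
Proof.
move=> fS; apply/continuousEP => x.
by rewrite projection_ergodic_map (pairing_Fix fS (ergodic_mapP x)).
Qed.

Let P_linear (r : R) f g : P (r *: f + g) = r *: P f + P g.
Proof.
apply/continuousEP => x.
by rewrite cED cEZ !projection_ergodic_map pairingDl pairingZl.
Qed.

Let P_ge0 f : (forall x, 0 <= f x) -> forall x, 0 <= P f x.
Proof.
move=> f0 x; have [pPhi _ _] := ergodic_mapP x.
rewrite projection_ergodic_map -(pairing_cst pPhi 0).
by apply: pairing_le => // y; rewrite cst_cE.
Qed.

(** [P] is positive, so its adjoint maps a positive measure to a positive
    functional, that is, to a measure. *)
Lemma adjoint_exists nu : exists mu, forall f, pairing f mu = pairing (P f) nu.
Proof.
have pos (m : {finite_measure set (borel X) -> \bar R}) :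
    exists m' : {finite_measure set (borel X) -> \bar R},
      forall f, \int[m']_x f x = \int[m]_x P f x.
  have lin : scalar (fun f => \int[m]_x P f x).
    by move=> r u v; rewrite P_linear int_ctsD int_ctsZ.
  pose l : {scalar C R X} := HB.pack (fun f => \int[m]_x P f x)
    (GRing.isLinear.Build R _ R *%R _ lin).
  by apply: (@riesz_representation R X l) => f f0; apply: int_cts_ge0; exact: P_ge0.
have [_ [m1 [m2 [_ _ _ nuE]]]] := hahn_M nu.
have [m1' m1E] := pos m1; have [m2' m2E] := pos m2.
exists (measure_M m1' - measure_M m2') => f.
by rewrite pairingBr !pairing_measure m1E m2E (pairing_diff nuE).
Qed.

Lemma direct_sum_dual : direct_sum FixM CobM.
Proof.
split=> [nu|].
  have [mu muP] := adjoint_exists nu; exists mu, (nu - mu); split.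
  - apply/invariantP => s f; rewrite !muP; congr (pairing _ nu).
    apply/continuousEP => x; rewrite !projection_ergodic_map.
    by have [_ /invariantP] := ergodic_mapP x.
  - by apply/CobM_annihilator => f fS; rewrite pairingBr muP projection_Fix// subrr.
  - by rewrite addrC subrK.
apply/seteqP; split=> [nu [nuS nuC]|_ ->]; last first.
  split; first exact: FixM_subspace.1.
  by apply/CobM_annihilator => f _; exact: pairing0r.
apply: pairing_inj => f; rewrite pairing0r -[f](subrK (P f)) pairingDl.
have [PF PC] := projection_alongP dsC f.
by rewrite ((CobC_annihilator _).1 PC nu nuS) ((CobM_annihilator _).1 nuC _ PF) addr0.
Qed.

(** Split [f] into [P f] and a limit of coboundaries: [mu] ignores the latter
    and [nu - mu] ignores [P f]. *)
Lemma dual_projection_pairing f nu mu : FixM mu -> CobM (nu - mu) ->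
  pairing f mu = pairing (P f) nu.
Proof.
move=> muS /CobM_annihilator numu; have [PF PC] := projection_alongP dsC f.
rewrite -[f in LHS](subrK (P f)) pairingDl ((CobC_annihilator _).1 PC mu muS) add0r.
by apply/esym/eqP; rewrite -subr_eq0 -pairingBr numu.
Qed.

End projection.

(** With [Phi] continuous, [x |-> <f, Phi x>] is a fixed continuous function, and
    its difference with [f] has integral 0 against the invariant measure of each
    orbit closure, hence against every invariant measure by localisation; the
    annihilator of these is the closure of the coboundaries. *)
Lemma ergodic_direct_sum : continuously_pointwise_ergodic R a ->
  direct_sum FixC CobC.
Proof.
move=> [ue Phic].
have Phi_uniq x mu : invariant_probabilities a (K x) mu -> mu = Phi x.
  by have [nu [_ nuP]] := ue x => /nuP <-; exact/nuP/ergodic_mapP.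
split=> [f|].
  pose p : C R X := mkcts ((weak_continuousP Phi).2 Phic f).
  have pE x : p x = pairing f (Phi x) by [].
  have pS : FixC p.
    move=> s; apply/continuousEP => x; rewrite koopmanE !pE; congr pairing.
    by apply/Phi_uniq/(@invariant_probabilities_orbit s); exact: ergodic_mapP.
  exists p, (f - p); split => //; last by rewrite addrC subrK.
  apply/CobC_annihilator => nu nuS; apply: invariant_pairing0 => // x mu muK.
  by rewrite pairingBl (pairing_Fix pS muK) pE -(Phi_uniq x mu muK) subrr.
apply/seteqP; split=> [f [fS /CobC_annihilator fC]|_ ->].
  apply/continuousEP => x; rewrite cE0 -(pairing_Fix fS (ergodic_mapP x)).
  by apply: fC; have [] := ergodic_mapP x.
split; first exact: FixC_subspace.1.
by apply/CobC_annihilator => nu _; exact: pairing0l.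
Qed.

(** Two invariant probability measures on the same orbit closure differ by an
    invariant measure killing the fixed functions, that is by 0. The same
    triviality makes sums of fixed functions and coboundaries dense; for these
    [x |-> <f, Phi x>] is continuous, and uniform limits preserve this. *)
Lemma dual_direct_sum_ergodic : direct_sum FixM CobM ->
  continuously_pointwise_ergodic R a.
Proof.
move=> [_ FC0]; split=> [x|].
  have [mu muK] := adm x; exists mu; split => // nu nuK.
  suff : (FixM `&` CobM) (mu - nu).
    by rewrite FC0 => /eqP; rewrite subr_eq0 => /eqP.
  split.
    have [_ muS _] := muK; have [_ nuS _] := nuK.
    exact: (subspaceB FixM_subspace).
  apply/CobM_annihilator => f fS.
  by rewrite pairingBr (pairing_Fix fS muK) (pairing_Fix fS nuK) subrr.
pose W : set (C R X) := [set f | exists u w, [/\ FixC u, Cob T w & f = u + w]].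
have Cs : linear_subspace (Cob T) by exact: linear_span_subspace.
have Ws : linear_subspace W.
  split; first by exists 0, 0; rewrite addr0; split=> //; [exact: FixC_subspace.1|exact: Cs.1].
  move=> r _ _ [u [w [uS wC ->]]] [u' [w' [uS' wC' ->]]].
  exists (r *: u + u'), (r *: w + w'); split.
  - exact: FixC_subspace.2.
  - exact: Cs.2.
  - by rewrite scalerDr addrACA.
have dense f : closure W f.
  apply: contrapT => /(closure_separation Ws)[nu [nuW /eqP]]; apply.
  suff -> : nu = 0 by rewrite pairing0r.
  suff : (FixM `&` CobM) nu by rewrite FC0.
  split.
    apply/Cob_koopman_annihilator => w wC; apply: nuW; exists 0, w.
    by rewrite add0r; split=> //; exact: FixC_subspace.1.
  apply/CobM_annihilator => u uS; apply: nuW; exists u, 0.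
  by rewrite addr0; split=> //; exact: Cs.1.
apply/weak_continuousP => f x; apply/cvgrPdist_le => e e0.
have e3 : 0 < e / 3 by rewrite divr_gt0.
have /closureCP/(_ _ e3)[_ [u [w [uS wC ->]]] /ltW fuw] := dense f.
have close y : `|pairing f (Phi y) - u y| <= e / 3.
  have [pPhi PhiS _] := ergodic_mapP y.
  have uwy : pairing (u + w) (Phi y) = u y.
    rewrite pairingDl (pairing_Fix uS (ergodic_mapP y)).
    by rewrite ((Cob_koopman_annihilator _).2 PhiS w wC) addr0.
  have fuwz z : - (e / 3) <= (f - (u + w)) z <= e / 3.
    by rewrite -ler_norml (le_trans (sup_norm_ge _ z)).
  rewrite -uwy -pairingBl ler_norml; apply/andP; split.
    rewrite -(pairing_cst pPhi (- (e / 3))).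
    by apply: (pairing_le pPhi) => z; rewrite cst_cE; have /andP[] := fuwz z.
  rewrite -(pairing_cst pPhi (e / 3)).
  by apply: (pairing_le pPhi) => z; rewrite cst_cE; have /andP[] := fuwz z.
have /cvgrPdist_le/(_ _ e3) := @cts_fun _ _ u x.
apply: filterS => y uxy; move: (close x) (close y) uxy.
rewrite !ler_norml => /andP[h1 h2] /andP[h3 h4] /andP[h5 h6].
by apply/andP; split; lra.
Qed.

End admitting.

End pointwise_ergodic_actions.
(** * The equivalence *)

Theorem theorem3p3 (R : realType) (S : semigroupType) (X : compactMetricType R)
    (a : cts_action S X) (adm : pointwise_invariant_measure_admitting R a) :
  let FixC := Fix (koopman R a) in
  let CobC := closure (Cob (koopman R a)) in
  let FixM := Fix (dual_koopman R a) in
  let CobM := closure (Cob (dual_koopman R a)) in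
  let P := projection_along FixC CobC in
  let Q := projection_along FixM CobM in
  let Phi := ergodic_map R a in
  [<-> continuously_pointwise_ergodic R a;
       direct_sum FixC CobC;
       direct_sum FixM CobM] /\
  (continuously_pointwise_ergodic R a \/
     direct_sum FixC CobC \/ direct_sum FixM CobM ->
   [/\ forall (f : C R X) (x : X), P f x = pairing f (Phi x),
       forall nu : M R X, is_gelfand_integral Phi nu (Q nu)
     & (exists! Pstar : M R X -> M R X, is_adjoint P Pstar) /\
       (forall Pstar : M R X -> M R X, is_adjoint P Pstar ->
          Pstar = Q /\ forall x : X, Pstar (delta R x) = Phi x)]).
Proof.
move=> FixC CobC FixM CobM P Q Phi.
have main : [<-> continuously_pointwise_ergodic R a;
    direct_sum FixC CobC; direct_sum FixM CobM].
  tfae.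
  - exact: ergodic_direct_sum.
  - exact: direct_sum_dual.
  - exact: dual_direct_sum_ergodic.
split=> // any.
have dsC : direct_sum FixC CobC.
  by case: any => [|[|]] //; [exact: (main 0 1).1|exact: (main 2 1).1].
have dsM : direct_sum FixM CobM by exact: (main 1 2).1.
have Qadj f nu : pairing f (Q nu) = pairing (P f) nu.
  have [QF QC] := projection_alongP dsM nu.
  exact: dual_projection_pairing.
have PE f x : P f x = pairing f (Phi x) by exact: projection_ergodic_map.
have adjE Pstar : is_adjoint P Pstar -> Pstar = Q.
  move=> adj; apply/funext => nu; apply: pairing_inj => f.
  by rewrite Qadj; exact: adj.
split=> [//|nu|].
  split=> f.
    by under eq_fun do rewrite -PE; exact: measurable_cts.
  by rewrite Qadj /pairing; congr integralM; apply/funext => x; exact: PE.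
split=> [|Pstar adj].
  exists Q; split=> [f nu|Pstar adj]; first exact: Qadj.
  by rewrite (adjE Pstar).
split=> [|x]; first exact: adjE.
by apply: pairing_inj => f; rewrite (adjE _ adj) Qadj pairing_delta PE.
Qed.
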